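(* Let $\mathbb{T}^2=(\mathbb{R}/\mathbb{Z})^2$ with its flat metric, and let $0=\lambda_1(\mathbb{T}^2)\le\lambda_2(\mathbb{T}^2)\le\cdots$ be the eigenvalues of $-\Delta_{\mathbb{T}^2}$, listed in non-decreasing order and counted with multiplicity. An eigenvalue $\lambda$ of $-\Delta_{\mathbb{T}^2}$ is Courant-sharp if and only if $\lambda=\lambda_k(\mathbb{T}^2)$ for some $k\in\{1,2,3,4,5\}$, i.e. if and only if $\lambda\in\{0,4\pi^2\}$.
   Context: $-\Delta_{\mathbb{T}^2}$ is the Laplace–Beltrami operator of the flat torus $\mathbb{T}^2=(\mathbb{R}/\mathbb{Z})^2$. For an eigenfunction $u$ of $-\Delta_{\mathbb{T}^2}$, the nodal domains of $u$ are the connected components of $\mathbb{T}^2\setminus u^{-1}(\{0\})$, and $\mu(u)$ denotes their number. For an eigenvalue $\lambda$, $\nu(\lambda)=\min\{k\ge 1:\lambda_k(\mathbb{T}^2)=\lambda\}$. An eigenvalue $\lambda$ is called Courant-sharp if there exists an eigenfunction $u$ associated with $\lambda$ with $\mu(u)=\nu(\lambda)$. *)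

(* Defs.v *)
From Stdlib Require Import Reals Lra Lia List ZArith.
Open Scope R_scope.

(* Functions on T^2 = (R/Z)^2 are represented as Z^2-periodic functions R -> R -> R. *)
Definition periodic (u : R -> R -> R) : Prop :=
  forall x y, u (x + 1) y = u x y /\ u x (y + 1) = u x y.

Definition cont2 (f : R -> R -> R) : Prop :=
  forall x y eps, 0 < eps -> exists d, 0 < d /\
    forall x' y', Rabs (x' - x) < d -> Rabs (y' - y) < d ->
      Rabs (f x' y' - f x y) < eps.

Definition is_eigenfunction (lam : R) (u : R -> R -> R) : Prop :=
  periodic u /\ (exists x y, u x y <> 0) /\
  exists ux uy uxx uxy uyx uyy : R -> R -> R,
    (forall x y, derivable_pt_lim (fun t => u t y) x (ux x y)) /\
    (forall x y, derivable_pt_lim (fun t => u x t) y (uy x y)) /\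
    (forall x y, derivable_pt_lim (fun t => ux t y) x (uxx x y)) /\
    (forall x y, derivable_pt_lim (fun t => ux x t) y (uxy x y)) /\
    (forall x y, derivable_pt_lim (fun t => uy t y) x (uyx x y)) /\
    (forall x y, derivable_pt_lim (fun t => uy x t) y (uyy x y)) /\
    cont2 u /\ cont2 ux /\ cont2 uy /\
    cont2 uxx /\ cont2 uxy /\ cont2 uyx /\ cont2 uyy /\
    (forall x y, - (uxx x y + uyy x y) = lam * u x y).

Definition is_eigenvalue (lam : R) : Prop := exists u, is_eigenfunction lam u.

Fixpoint lincomb (cs : list R) (fs : list (R -> R -> R)) (x y : R) : R :=
  match cs, fs with
  | c :: cs', f :: fs' => c * f x y + lincomb cs' fs' x y
  | _, _ => 0
  end.

Definition lin_indep (fs : list (R -> R -> R)) : Prop :=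
  forall cs : list R, length cs = length fs ->
    (forall x y, lincomb cs fs x y = 0) -> forall c, In c cs -> c = 0.

Definition eig_family (P : R -> Prop) (fs : list (R -> R -> R)) : Prop :=
  lin_indep fs /\ forall f, In f fs -> exists mu, P mu /\ is_eigenfunction mu f.

(* n = number of eigenvalues (counted with multiplicity) lying in P
     = dimension of the sum of the eigenspaces E_mu, mu in P *)
Definition eig_count (P : R -> Prop) (n : nat) : Prop :=
  (exists fs, eig_family P fs /\ length fs = n) /\
  (forall fs, eig_family P fs -> (length fs <= n)%nat).

(* lambda_k(T^2) = lam  (k >= 1), eigenvalues listed nondecreasingly with multiplicity:
   #{eigenvalues < lam} < k <= #{eigenvalues <= lam} *)
Definition lambda_k (k : nat) (lam : R) : Prop :=
  exists a b, eig_count (fun mu => mu < lam) a /\ eig_count (fun mu => mu <= lam) b /\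
    (a < k)%nat /\ (k <= b)%nat.

Definition nu (lam : R) (k : nat) : Prop :=
  (1 <= k)%nat /\ lambda_k k lam /\ forall j, (1 <= j)%nat -> lambda_k j lam -> (k <= j)%nat.

Definition cont01 (g : R -> R) : Prop :=
  forall t, 0 <= t <= 1 -> forall eps, 0 < eps -> exists d, 0 < d /\
    forall s, 0 <= s <= 1 -> Rabs (s - t) < d -> Rabs (g s - g t) < eps.

(* the points p, q of T^2 \ u^{-1}(0) lie in the same (path) component of T^2 \ u^{-1}(0):
   a path in the torus lifts to a path in R^2 from p to a Z^2-translate of q *)
Definition nodal_rel (u : R -> R -> R) (p q : R * R) : Prop :=
  exists (g1 g2 : R -> R) (m n : Z), cont01 g1 /\ cont01 g2 /\
    g1 0 = fst p /\ g2 0 = snd p /\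
    g1 1 = fst q + IZR m /\ g2 1 = snd q + IZR n /\
    forall t, 0 <= t <= 1 -> u (g1 t) (g2 t) <> 0.

Definition nodal_count (u : R -> R -> R) (k : nat) : Prop :=
  exists ps : list (R * R), length ps = k /\
    (forall p, In p ps -> u (fst p) (snd p) <> 0) /\
    (forall i j, (i < k)%nat -> (j < k)%nat -> i <> j ->
       ~ nodal_rel u (nth i ps (0, 0)) (nth j ps (0, 0))) /\
    (forall x y, u x y <> 0 -> exists p, In p ps /\ nodal_rel u (x, y) p).

Definition courant_sharp (lam : R) : Prop :=
  exists u k, is_eigenfunction lam u /\ nu lam k /\ nodal_count u k.

(* Main.v *)
(* Write the eigenvalue as [4 pi^2 N]; an eigenfunction [u] is a trigonometric polynomial with
   frequencies on the circle [m^2 + n^2 = N].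

   Let [p], [q] be coprime and [D >= |p m + q n|, |- q m + p n|] for these frequencies. On a closed
   line of direction [(- q, p)] or [(p, q)], [u] is a trigonometric polynomial of degree at most [D],
   so such a line meets at most [2 D] nodal domains. On the other hand a nodal domain inside an
   [a x b] rectangle satisfies [1 / a^2 + 1 / b^2 <= 4 N] by a maximum principle argument, hence
   [a + b >= sqrt (2 / N)]. Double counting the incidences between nodal domains and lines gives
   [k^2 (p^2 + q^2) <= 8 D^2 N] for the number [k] of nodal domains.

   If [u] is Courant-sharp then [k] exceeds the number of lattice points with [m^2 + n^2 < N], which is
   about [pi N], whereas [(p, q) = (1, 0)] and [D = floor (sqrt N)] give [k <= 2 sqrt 2 N]. This is
   contradictory for all [N >= 2] except [N = 4] and [N = 25], which the directions [(1, 1)] and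
   [(3, 1)] exclude. *)
Require Import Defs.
From Stdlib Require Import Reals.
From Stdlib Require Import Lra Lia Psatz List ZArith ClassicalEpsilon FunctionalExtensionality.
From Coquelicot Require Import Coquelicot.
Import ListNotations.
Open Scope R_scope.

(** * Lattice points in a disc *)

(** The usual lower bound for the area of a nodal domain rests on an isoperimetric inequality. Here
    a domain is measured by its widths [a], [b] in two orthogonal directions, which asks only for
    paths, zeros in one variable and a comparison function. The passage to [a + b] is
    [1 / a^2 + 1 / b^2 >= 8 / (a + b)^2]. The incidence count is discrete: each direction has [K]
    equally spaced closed lines, and the rounding error per domain becomes negligible as [K] grows.
    A domain that winds round the torus has no enclosing rectangle; it then meets all [K] lines of
    one direction, and [2 (p^2 + q^2) <= N] makes that alone sufficient. The final bound depends on
    the direction only through [D / sqrt (p^2 + q^2)]. For [N = 4] and [N = 25] the circle has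
    lattice points on the axes, so [(1, 0)] gives the full radius and allows [k <= 11] and
    [k <= 70], where sharpness asks for [k >= 10] and [k >= 70]. The oblique directions lower the
    ratio to [2 / sqrt 2] and [15 / sqrt 10]. *)

Definition zrange (B : Z) : list Z :=
  map (fun i => (Z.of_nat i - B)%Z) (seq 0 (Z.to_nat (2 * B + 1))).

(** Integrality turns [m^2 + n^2 < N] into [m^2 + n^2 <= N - 1], so that the ends of the rows are
    integer square roots and the count can be evaluated. *)
Definition pts (N : Z) : list (Z * Z) :=
  flat_map (fun m => map (pair m) (zrange (Z.sqrt (N - 1 - m * m))))
    (zrange (Z.sqrt (N - 1))).

Lemma in_zrange B m : (0 <= B)%Z -> (In m (zrange B) <-> (- B <= m <= B)%Z).
Proof.
  intros HB; unfold zrange; rewrite in_map_iff; split.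
  - intros [i [<- Hi]]; apply in_seq in Hi; lia.
  - intros H; exists (Z.to_nat (m + B)); rewrite in_seq; lia.
Qed.

Lemma NoDup_map_inj {A B : Type} (f : A -> B) (l : list A) :
  (forall x y, In x l -> In y l -> f x = f y -> x = y) -> NoDup l -> NoDup (map f l).
Proof.
  intros Hf Hl; induction Hl as [|a l Ha Hl IH]; simpl; constructor.
  - rewrite in_map_iff; intros [b [Hb1 Hb2]]; apply Ha.
    rewrite <- (Hf b a); simpl; auto.
  - apply IH; intros; apply Hf; simpl; auto.
Qed.

Lemma NoDup_zrange B : NoDup (zrange B).
Proof.
  apply NoDup_map_inj; [intros; lia | apply seq_NoDup].
Qed.

Lemma NoDup_fibres {A B : Type} (f : A -> list B) (l : list A) :
  NoDup l -> (forall a, NoDup (f a)) ->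
  NoDup (flat_map (fun a => map (pair a) (f a)) l).
Proof.
  intros Hl Hf; induction Hl as [|a l Ha Hl IH]; simpl; [constructor|].
  apply NoDup_app; auto.
  - apply NoDup_map_inj; auto; intros x y _ _ [=]; auto.
  - intros [a' b] H1 H2; apply in_map_iff in H1 as [b1 [[= <- <-] _]].
    apply in_flat_map in H2 as [a2 [H2 H3]].
    apply in_map_iff in H3 as [b2 [[= -> _] _]]; auto.
Qed.

Lemma NoDup_pts N : NoDup (pts N).
Proof. apply NoDup_fibres; intros; apply NoDup_zrange. Qed.

Lemma in_pts N m n : (1 <= N)%Z -> In (m, n) (pts N) -> (m * m + n * n < N)%Z.
Proof.
  intros HN H; apply in_flat_map in H as [m' [H1 H2]].
  apply in_map_iff in H2 as [n' [[= -> ->] H2]].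
  apply in_zrange in H1; [|apply Z.sqrt_nonneg].
  apply in_zrange in H2; [|apply Z.sqrt_nonneg].
  destruct (Z.sqrt_spec (N - 1) ltac:(lia)) as [Hs _].
  set (s := Z.sqrt (N - 1)) in *; clearbody s.
  assert (m * m <= s * s)%Z by nia.
  destruct (Z.sqrt_spec (N - 1 - m * m) ltac:(lia)) as [Ht _].
  set (t := Z.sqrt (N - 1 - m * m)) in *; clearbody t.
  assert (n * n <= t * t)%Z by nia.
  lia.
Qed.

Definition zsum (f : Z -> Z) (l : list Z) : Z := fold_right (fun m s => f m + s)%Z 0%Z l.

(** The range [B] of the rows is kept apart from [N]: lowering [N] to [B^2 + 1] with the same rows
    leaves a function of [B] alone. *)
Definition rowcount (N B : Z) : Z :=
  zsum (fun m => 2 * Z.sqrt (N - 1 - m * m) + 1)%Z (zrange B).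

Lemma length_zrange B : (0 <= B)%Z -> Z.of_nat (length (zrange B)) = (2 * B + 1)%Z.
Proof. intros; unfold zrange; rewrite length_map, length_seq; lia. Qed.

Lemma length_pts N : Z.of_nat (length (pts N)) = rowcount N (Z.sqrt (N - 1)).
Proof.
  unfold rowcount, pts; induction (zrange (Z.sqrt (N - 1))) as [|m l IH]; simpl; auto.
  rewrite length_app, length_map, Nat2Z.inj_add, IH, length_zrange; auto.
  apply Z.sqrt_nonneg.
Qed.

Lemma zsum_le f g l : (forall m, In m l -> f m <= g m)%Z -> (zsum f l <= zsum g l)%Z.
Proof.
  induction l as [|a l IH]; simpl; intros H; [lia|].
  specialize (IH (fun m Hm => H m (or_intror Hm))); specialize (H a (or_introl eq_refl)); lia.
Qed.

Lemma zsum_mul c f l : zsum (fun m => c * f m)%Z l = (c * zsum f l)%Z.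
Proof. induction l as [|a l IH]; simpl; [ring|rewrite IH; ring]. Qed.

Lemma zsum_app f l l' : zsum f (l ++ l') = (zsum f l + zsum f l')%Z.
Proof. induction l as [|a l IH]; simpl; [ring|rewrite IH; ring]. Qed.

(** Power sums of [i - B], for an arbitrary number [n] of terms so that induction applies; the whole
    disc is [n = 2 * B + 1]. *)
Lemma sum_rows_poly B n :
  (30 * zsum (fun m => 2 * B^4 - B^2 * m^2 - m^4 - B^3) (map (fun i => Z.of_nat i - B) (seq 0 n))
  = let N := Z.of_nat n in
    30 * N * (2 * B^4 - B^3)
    - 30 * B^2 * (N * B^2 - B * N * (N-1)) - 5 * B^2 * (N-1) * N * (2*N-1)
    - 30 * (N * B^4 - 2 * B^3 * N * (N-1))
    - 30 * B^2 * (N-1) * N * (2 * N - 1)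
    + 30 * B * N^2 * (N-1)^2
    - (N-1) * N * (2*N-1) * (3*N^2-3*N-1))%Z.
Proof.
  induction n as [|n IH]; [simpl seq; simpl map; simpl zsum; cbn zeta; change (Z.of_nat 0) with 0%Z; ring|].
  rewrite seq_S, map_app, zsum_app, Z.mul_add_distr_l, IH.
  cbn zeta; rewrite Nat2Z.inj_succ; unfold Z.succ; cbn [map zsum fold_right Nat.add]; ring.
Qed.

(* This is [f + 1 >= sqrt (B^2 - m^2) >= B (1 - s/2 - s^2/2)], [s = m^2 / B^2], multiplied by
   [2 B^3], for the length [2 f + 1] of the row [m] of the disc. *)
Lemma row_bound B N m : (0 < B)%Z -> (B^2 + 1 <= N)%Z -> (- B <= m <= B)%Z ->
  (2 * B^4 - B^2 * m^2 - m^4 - B^3 <= B^3 * (2 * Z.sqrt (N - 1 - m * m) + 1))%Z.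
Proof.
  intros HB HN Hm.
  assert (Hm2 : (m * m <= B * B)%Z) by nia.
  pose proof (Z.sqrt_spec (N - 1 - m * m) ltac:(nia)) as [_ Hf].
  pose proof (Z.sqrt_nonneg (N - 1 - m * m)) as Hf0.
  set (f := Z.sqrt (N - 1 - m * m)) in *; clearbody f.
  assert (H1 : (B * B - m * m <= (f + 1) * (f + 1))%Z) by (unfold Z.succ in Hf; nia).
  set (X := (B * B - m * m)%Z) in *.
  assert (HX : (0 <= X)%Z) by (unfold X; lia).
  set (M := (m * m)%Z) in *.
  assert (HM : (0 <= M)%Z) by (unfold M; nia).
  (* Both sides are squared: [X * (2 * B^2 + M)^2 = 4 * B^6 - 3 * B^2 * M^2 - M^3] and
     [X <= (f + 1)^2]. *)
  assert (H2 : (X * (2 * B^2 + M) <= 2 * B^3 * (f + 1))%Z).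
  { apply Z.square_le_simpl_nonneg.
    - apply Z.mul_nonneg_nonneg; [apply Z.mul_nonneg_nonneg; [lia|]|lia].
      apply Z.pow_nonneg; lia.
    - apply Z.le_trans with (4 * B^6 * X)%Z.
      + replace (X * (2 * B^2 + M) * (X * (2 * B^2 + M)))%Z
          with (X * (X * (2 * B^2 + M)^2))%Z by ring.
        rewrite (Z.mul_comm (4 * B^6) X).
        apply Z.mul_le_mono_nonneg_l; auto.
        unfold X; assert (0 <= B * B)%Z by nia.
        assert (0 <= 3 * B^2 * M^2 + M^3)%Z.
        { assert (0 <= M^3)%Z by (apply Z.pow_nonneg; lia).
          assert (0 <= B^2 * M^2)%Z by (apply Z.mul_nonneg_nonneg; apply Z.pow_nonneg; lia).
          lia. }
        replace ((B * B - M) * (2 * B ^ 2 + M) ^ 2)%Z with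
          (4 * B^6 - (3 * B^2 * M^2 + M^3))%Z by ring.
        lia.
      + replace (2 * B ^ 3 * (f + 1) * (2 * B ^ 3 * (f + 1)))%Z with
          (4 * B^6 * ((f + 1) * (f + 1)))%Z by ring.
        apply Z.mul_le_mono_nonneg_l; auto.
        assert (0 <= B^6)%Z by (apply Z.pow_nonneg; lia); lia. }
  replace (2 * B ^ 4 - B ^ 2 * m ^ 2 - m ^ 4 - B ^ 3)%Z with
    (X * (2 * B^2 + M) - B^3)%Z by (unfold X, M; ring).
  replace (B ^ 3 * (2 * f + 1))%Z with (2 * B^3 * (f + 1) - B^3)%Z by ring.
  lia.
Qed.

Lemma rowcount_mono N N' B : (N <= N')%Z -> (rowcount N B <= rowcount N' B)%Z.
Proof.
  intros H; apply zsum_le; intros m _.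
  assert (Z.sqrt (N - 1 - m * m) <= Z.sqrt (N' - 1 - m * m))%Z by (apply Z.sqrt_le_mono; lia).
  lia.
Qed.

(** Summed over the rows, the bound of [row_bound] has leading term [(44 / 15) * B^2], and [44 / 15]
    still exceeds [2 sqrt 2]. *)
Lemma rowcount_large B : (80 <= B)%Z ->
  (8 * (B + 1)^4 < (rowcount (B^2 + 1) B + 1)^2)%Z.
Proof.
  intros HB.
  assert (HB3 : (0 < B^3)%Z) by (apply Z.pow_pos_nonneg; lia).
  assert (H1 : (zsum (fun m => 2 * B^4 - B^2 * m^2 - m^4 - B^3) (zrange B)
            <= B^3 * rowcount (B^2+1) B)%Z).
  { unfold rowcount; rewrite <- zsum_mul; apply zsum_le; intros m Hm.
    apply in_zrange in Hm; [|lia]; apply row_bound; lia. }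
  unfold zrange in H1.
  assert (H2 := sum_rows_poly B (Z.to_nat (2 * B + 1))).
  rewrite Z2Nat.id in H2 by lia; cbn zeta in H2.
  set (S := zsum _ _) in *.
  set (A := rowcount _ _) in *.
  assert (H3 : (30 * S = 88 * B^5 - 60 * B^4 - 60 * B^3 + 2 * B)%Z) by (rewrite H2; ring).
  assert (H4 : (88 * B^2 - 60 * B - 60 <= 30 * A)%Z).
  { apply Z.mul_le_mono_pos_l with (B^3)%Z; [lia|].
    replace (B^3 * (88 * B^2 - 60 * B - 60))%Z with
      (88 * B^5 - 60 * B^4 - 60 * B^3)%Z by ring.
    lia. }
  (* [85 / 30] lies between [2 sqrt 2] and [88 / 30], as [85^2 = 7225 > 8 * 30^2 = 7200]. Absorbing
     the linear terms into the difference [88 - 85] is what requires [80 <= B]. *)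
  assert (H5 : (85 * (B + 1)^2 <= 30 * (A + 1))%Z) by nia.
  assert (H6 : (0 < (B + 1)^2)%Z) by (apply Z.pow_pos_nonneg; lia).
  replace (8 * (B + 1)^4)%Z with (8 * ((B + 1)^2 * (B + 1)^2))%Z by ring.
  replace ((A + 1)^2)%Z with ((A + 1) * (A + 1))%Z by ring.
  nia.
Qed.

Lemma forallb_seq (f : nat -> bool) a n :
  forallb f (seq a n) = true -> forall i, (a <= i < a + n)%nat -> f i = true.
Proof. rewrite forallb_forall; intros H i Hi; apply H, in_seq; lia. Qed.

Lemma rowcount_medium B : (20 <= B)%Z ->
  (8 * (B + 1)^4 < (rowcount (B^2 + 1) B + 1)^2)%Z.
Proof.
  intros HB; destruct (Z_le_gt_dec 80 B) as [H|H]; [now apply rowcount_large|].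
  assert (H1 : forallb (fun i => let B := Z.of_nat i in
    (8 * (B + 1)^4 <? (rowcount (B^2 + 1) B + 1)^2)%Z) (seq 20 60) = true)
    by (vm_compute; reflexivity).
  apply forallb_seq with (i := Z.to_nat B) in H1; [|lia].
  rewrite Z2Nat.id in H1 by lia; now apply Z.ltb_lt.
Qed.

Lemma length_pts_bound N : (2 <= N)%Z -> N <> 4%Z -> N <> 25%Z ->
  (8 * Z.sqrt N ^ 2 * N < (Z.of_nat (length (pts N)) + 1)^2)%Z.
Proof.
  intros HN H4 H25; rewrite length_pts.
  destruct (Z_le_gt_dec 401 N) as [H|H].
  - destruct (Z.sqrt_spec (N - 1) ltac:(lia)) as [Hs1 Hs2].
    assert (HB : (20 <= Z.sqrt (N - 1))%Z)
      by (change 20%Z with (Z.sqrt 400); apply Z.sqrt_le_mono; lia).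
    set (B := Z.sqrt (N - 1)) in *; clearbody B.
    (* [B^2 + 1 <= N <= (B + 1)^2]: the left side is bounded at the upper end and the lattice count
       at the lower end. *)
    apply Z.le_lt_trans with (8 * (B + 1)^4)%Z.
    + assert (HD : (Z.sqrt N <= B + 1)%Z).
      { apply Z.lt_succ_r, Z.sqrt_lt_square; unfold Z.succ in *; nia. }
      pose proof (Z.sqrt_nonneg N).
      assert (Z.sqrt N ^ 2 <= (B + 1)^2)%Z by nia.
      assert (N <= (B + 1)^2)%Z by (unfold Z.succ in *; nia).
      replace (8 * (B + 1)^4)%Z with (8 * ((B + 1)^2 * (B + 1)^2))%Z by ring.
      nia.
    + apply Z.lt_le_trans with (1 := rowcount_medium B HB).
      assert (0 <= rowcount (B^2 + 1) B)%Z.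
      { assert (H1 := zsum_le (fun _ => 0)%Z
          (fun m => 2 * Z.sqrt (B ^ 2 + 1 - 1 - m * m) + 1)%Z (zrange B)).
        replace (zsum (fun _ => 0%Z) (zrange B)) with 0%Z in H1
          by (generalize (zrange B) as l; induction l; simpl; auto).
        apply H1; intros m _; pose proof (Z.sqrt_nonneg (B ^ 2 + 1 - 1 - m * m)); lia. }
      assert (rowcount (B^2 + 1) B <= rowcount N B)%Z by (apply rowcount_mono; lia).
      nia.
  (* At the two excluded values the inequality fails: [128] against [10^2] for [N = 4], [5000]
     against [70^2] for [N = 25]. *)
  - assert (H1 : forallb (fun i => let N := Z.of_nat i in
      (N =? 4) || (N =? 25) ||
      (8 * Z.sqrt N ^ 2 * N <? (rowcount N (Z.sqrt (N - 1)) + 1)^2))%bool%Z (seq 2 400) = true)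
      by (vm_compute; reflexivity).
    apply forallb_seq with (i := Z.to_nat N) in H1; [|lia].
    rewrite Z2Nat.id in H1 by lia; cbn zeta in H1.
    rewrite !Bool.orb_true_iff, !Z.eqb_eq, Z.ltb_lt in H1; lia.
Qed.

(** * Zeros of trigonometric polynomials *)

Definition horner (l : list C) (z : C) : C := fold_right (fun a s => (a + z * s)%C) (RtoC 0) l.

Lemma horner_divide l r : horner l r = RtoC 0 ->
  exists l', length l' = pred (length l) /\
    forall z, horner l z = ((z - r) * horner l' z)%C.
Proof.
  assert (H : forall l, exists l', length l' = pred (length l) /\
    forall z, (horner l z - horner l r)%C = ((z - r) * horner l' z)%C).
  { clear l; intros l; induction l as [|a l [l' [Hl' IH]]].
    - exists []; split; auto; intros z; simpl; ring.
    - destruct l as [|b l].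
      + exists []; split; auto; intros z; simpl; ring.
      + exists (horner (b :: l) r :: l'); split; [simpl in *; congruence|].
        intros z; specialize (IH z).
        change (horner (a :: b :: l) z) with (a + z * horner (b :: l) z)%C.
        change (horner (a :: b :: l) r) with (a + r * horner (b :: l) r)%C.
        change (horner (horner (b :: l) r :: l') z) with
          (horner (b :: l) r + z * horner l' z)%C.
        replace (a + z * horner (b :: l) z - (a + r * horner (b :: l) r))%C with
          (z * (horner (b :: l) z - horner (b :: l) r) + (z - r) * horner (b :: l) r)%C by ring.
        rewrite IH; ring. }
  intros H0; destruct (H l) as [l' [Hl1 Hl2]]; exists l'; split; auto.
  intros z; rewrite <- Hl2, H0; ring.
Qed.

Lemma horner_roots l zs : NoDup zs -> (length l <= length zs)%nat ->
  (forall r, In r zs -> horner l r = RtoC 0) -> forall z, horner l z = RtoC 0.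
Proof.
  intros Hd; revert l; induction Hd as [|r zs Hr Hd IH]; intros l Hl H0 z.
  - destruct l; simpl in *; [auto|lia].
  - destruct (horner_divide l r) as [l' [Hl1 Hl2]]; [apply H0; simpl; auto|].
    rewrite Hl2, (IH l'); [ring|simpl in *; lia|].
    intros r' Hr'; assert (Hne : (r' - r)%C <> RtoC 0).
    { intros E; apply Hr; replace r with r'; auto.
      replace r' with ((r' - r) + r)%C by ring; rewrite E; ring. }
    assert (E := Hl2 r'); rewrite H0 in E by (simpl; auto).
    replace (horner l' r') with (((r' - r) * horner l' r') / (r' - r))%C by (field; auto).
    rewrite <- E; field; auto.
Qed.

Definition poly_le (n : nat) (f : C -> C) : Prop :=
  exists l, (length l <= S n)%nat /\ forall z, f z = horner l z.

Lemma poly_le_plus n f g : poly_le n f -> poly_le n g -> poly_le n (fun z => f z + g z)%C.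
Proof.
  intros [l [Hl Hf]] [l' [Hl' Hg]].
  assert (H : forall l l', exists l'', length l'' = Nat.max (length l) (length l') /\
    forall z, (horner l z + horner l' z)%C = horner l'' z).
  { clear; intros l; induction l as [|a l IH]; intros l'.
    - exists l'; split; auto; intros; simpl; ring.
    - destruct l' as [|b l'].
      + exists (a :: l); split; auto; intros; simpl; ring.
      + destruct (IH l') as [l'' [H1 H2]]; exists ((a + b)%C :: l''); split; [simpl; auto|].
        intros z; simpl; rewrite <- H2; ring. }
  destruct (H l l') as [l'' [H1 H2]]; exists l''; split; [lia|].
  intros z; now rewrite Hf, Hg, H2.
Qed.

Lemma poly_le_monomial n k a : (k <= n)%nat -> poly_le n (fun z => a * z ^ k)%C.
Proof.
  intros H; exists (repeat (RtoC 0) k ++ [a]); split.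
  - rewrite length_app, repeat_length; simpl; lia.
  - intros z; clear H; induction k as [|k IH]; simpl in *; [ring|].
    rewrite <- IH; ring.
Qed.

Definition expi (t : R) : C := (cos (2 * PI * t), sin (2 * PI * t)).

Lemma expi_plus s t : expi (s + t) = (expi s * expi t)%C.
Proof.
  unfold expi, Cmult; simpl; rewrite !Rmult_plus_distr_l, cos_plus, sin_plus; f_equal; ring.
Qed.

Lemma expi_pow t k : (expi t ^ k)%C = expi (INR k * t).
Proof.
  induction k as [|k IH].
  - unfold expi; simpl; rewrite !Rmult_0_l, Rmult_0_r, cos_0, sin_0; auto.
  - rewrite S_INR, Rmult_plus_distr_r, Rmult_1_l, expi_plus, <- IH; simpl; ring.
Qed.

Lemma expi_inj s t : expi s = expi t -> exists k : Z, s = t + IZR k.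
Proof.
  intros [= H1 H2].
  assert (H : cos (2 * (PI * (s - t))) = 1).
  { replace (2 * (PI * (s - t))) with (2 * PI * s - 2 * PI * t) by ring.
    rewrite cos_minus, H1, H2.
    pose proof (sin2_cos2 (2 * PI * t)); unfold Rsqr in *; lra. }
  rewrite cos_2a_sin in H.
  assert (H0 : sin (PI * (s - t)) = 0) by nra.
  apply sin_eq_0_0 in H0 as [k Hk]; exists k.
  pose proof PI_RGT_0; apply Rmult_eq_reg_l with PI; [|lra].
  nra.
Qed.

(** Each triple is amplitude, phase, frequency; the phases absorb the base point when waves are
    restricted to a line. *)
Definition trig1 (l : list (R * R * Z)) (t : R) : R :=
  fold_right (fun '(c, f, k) s => c * cos (2 * PI * (IZR k * t) + f) + s) 0 l.

(* [cos (2 pi k t + f) * z^D], [z = e^(2 pi i t)], is a combination of [z^(D+k)] and [z^(D-k)]. *)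
Lemma trig1_poly D l : (forall c f k, In (c, f, k) l -> (Z.abs k <= Z.of_nat D)%Z) ->
  exists P, poly_le (2 * D) P /\ forall t, P (expi t) = (RtoC (trig1 l t) * expi t ^ D)%C.
Proof.
  induction l as [|[[c f] k] l IH]; intros Hk.
  - exists (fun _ => RtoC 0); split; [|intros; simpl; ring].
    exists []; split; simpl; auto; lia.
  - destruct IH as [P [HP1 HP2]]; [intros; apply (Hk c0 f0); simpl; auto|].
    specialize (Hk c f k (or_introl eq_refl)).
    set (a := (c / 2 * cos f, c / 2 * sin f) : C).
    set (b := (c / 2 * cos f, - (c / 2 * sin f)) : C).
    exists (fun z => a * z ^ Z.to_nat (Z.of_nat D + k) + b * z ^ Z.to_nat (Z.of_nat D - k) + P z)%C.
    split.
    + apply poly_le_plus; auto; apply poly_le_plus; apply poly_le_monomial; lia.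
    + intros t; rewrite HP2; simpl trig1.
      rewrite RtoC_plus, Cmult_plus_distr_r; f_equal.
      rewrite !expi_pow, !INR_IZR_INZ, !Z2Nat.id, plus_IZR, minus_IZR by lia.
      replace ((IZR (Z.of_nat D) + IZR k) * t) with (IZR (Z.of_nat D) * t + IZR k * t) by ring.
      replace ((IZR (Z.of_nat D) - IZR k) * t) with (IZR (Z.of_nat D) * t + - (IZR k * t)) by ring.
      rewrite !expi_plus.
      set (w := expi (IZR (Z.of_nat D) * t)).
      rewrite cos_plus; unfold a, b.
      replace (expi (- (IZR k * t))) with
        ((cos (2 * PI * (IZR k * t)), - sin (2 * PI * (IZR k * t))) : C)
        by (unfold expi; rewrite <- !Ropp_mult_distr_r, cos_neg, sin_neg; auto).
      unfold expi, Cmult, Cplus, RtoC; destruct w as [w1 w2]; simpl; f_equal; field.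
Qed.

Lemma trig1_roots D l zs :
  (forall c f k, In (c, f, k) l -> (Z.abs k <= Z.of_nat D)%Z) ->
  NoDup (map expi zs) -> (2 * D < length zs)%nat -> (forall z, In z zs -> trig1 l z = 0) ->
  forall t, trig1 l t = 0.
Proof.
  intros Hk Hd Hl H0 t; destruct (trig1_poly D l Hk) as [P [[q [Hq1 Hq2]] HP]].
  assert (HPt : P (expi t) = RtoC 0).
  { rewrite Hq2; apply horner_roots with (map expi zs); auto; [rewrite length_map; lia|].
    intros r Hr; apply in_map_iff in Hr as [z [<- Hz]].
    rewrite <- Hq2, HP, H0; auto; ring. }
  rewrite HP, expi_pow in HPt.
  unfold expi, RtoC, Cmult in HPt; simpl in HPt; injection HPt as H1 H2.
  set (a := 2 * PI * (INR D * t)) in *.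
  pose proof (sin2_cos2 a); unfold Rsqr in *; nra.
Qed.

(** * Paths and nodal domains *)

(** The retraction onto [[0, 1]]: composing with it extends a path to all of [R], where continuity
    carries no side conditions. *)
Definition clamp (t : R) : R := Rmax 0 (Rmin t 1).

Lemma clamp_range t : 0 <= clamp t <= 1.
Proof. unfold clamp, Rmax, Rmin; repeat destruct Rle_dec; lra. Qed.

Lemma clamp_id t : 0 <= t <= 1 -> clamp t = t.
Proof. unfold clamp, Rmax, Rmin; repeat destruct Rle_dec; lra. Qed.

Lemma clamp_lt0 t : t <= 0 -> clamp t = 0.
Proof. unfold clamp, Rmax, Rmin; repeat destruct Rle_dec; lra. Qed.

Lemma clamp_gt1 t : 1 <= t -> clamp t = 1.
Proof. unfold clamp, Rmax, Rmin; repeat destruct Rle_dec; lra. Qed.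

Lemma clamp_lip s t : Rabs (clamp s - clamp t) <= Rabs (s - t).
Proof.
  unfold clamp, Rmax, Rmin; repeat destruct Rle_dec; unfold Rabs; repeat destruct Rcase_abs; lra.
Qed.

Lemma continuity_eps (f : R -> R) :
  (forall t eps, 0 < eps -> exists d, 0 < d /\
     forall s, Rabs (s - t) < d -> Rabs (f s - f t) < eps) -> continuity f.
Proof.
  intros H t eps Heps; destruct (H t eps Heps) as [d [Hd H']]; exists d; split; auto.
  intros s [_ Hs]; apply H', Hs.
Qed.

Lemma continuity_eps_inv (f : R -> R) : continuity f ->
  forall t eps, 0 < eps -> exists d, 0 < d /\
     forall s, Rabs (s - t) < d -> Rabs (f s - f t) < eps.
Proof.
  intros H t eps Heps; destruct (H t eps Heps) as [d [Hd H']]; exists d; split; auto.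
  intros s Hs; destruct (Req_dec s t) as [->|Hst].
  - rewrite Rminus_diag, Rabs_R0; auto.
  - apply (H' s); split; [split; [exact I|auto]|exact Hs].
Qed.

Lemma continuity_clamp : continuity clamp.
Proof.
  apply continuity_eps; intros t eps H; exists eps; split; auto.
  intros s Hs; apply Rle_lt_trans with (1 := clamp_lip s t); auto.
Qed.

Lemma cont01_clamp g : cont01 g -> continuity (fun t => g (clamp t)).
Proof.
  intros H; apply continuity_eps; intros t eps Heps.
  destruct (H (clamp t) (clamp_range t) eps Heps) as [d [Hd H']]; exists d; split; auto.
  intros s Hs; apply H'; [apply clamp_range|].
  apply Rle_lt_trans with (1 := clamp_lip s t); auto.
Qed.

Lemma cont01_continuity g : continuity g -> cont01 g.
Proof.
  intros H t _ eps Heps; destruct (continuity_eps_inv g H t eps Heps) as [d [Hd H']].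
  exists d; split; auto.
Qed.

(** Connectedness in the covering plane, of which [nodal_rel] is the version up to lattice
    translation. The extent of a domain in a direction makes sense only in the plane. *)
Definition path (u : R -> R -> R) (p q : R * R) : Prop :=
  exists g1 g2 : R -> R, continuity g1 /\ continuity g2 /\
    g1 0 = fst p /\ g2 0 = snd p /\ g1 1 = fst q /\ g2 1 = snd q /\
    forall t, u (g1 t) (g2 t) <> 0.

Definition shift (p : R * R) (m n : Z) : R * R := (fst p + IZR m, snd p + IZR n).

Lemma nodal_rel_path u p q : nodal_rel u p q <-> exists m n, path u p (shift q m n).
Proof.
  split.
  - intros [g1 [g2 [m [n [H1 [H2 [H3 [H4 [H5 [H6 H7]]]]]]]]]]; exists m, n.
    exists (fun t => g1 (clamp t)), (fun t => g2 (clamp t)).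
    rewrite (clamp_id 0), (clamp_id 1) by lra.
    repeat split; auto using cont01_clamp.
    intros t; apply H7, clamp_range.
  - intros [m [n [g1 [g2 [H1 [H2 [H3 [H4 [H5 [H6 H7]]]]]]]]]].
    exists g1, g2, m, n; repeat split; auto using cont01_continuity.
Qed.

Lemma path_refl (u : R -> R -> R) p : u (fst p) (snd p) <> 0 -> path u p p.
Proof.
  intros H; exists (fun _ => fst p), (fun _ => snd p); repeat split; auto;
    apply continuity_const; intros ? ?; auto.
Qed.

Lemma path_sym u p q : path u p q -> path u q p.
Proof.
  intros [g1 [g2 [H1 [H2 [H3 [H4 [H5 [H6 H7]]]]]]]].
  exists (fun t => g1 (1 - t)), (fun t => g2 (1 - t)).
  assert (Hc : continuity (fun t => 1 - t)) by (intros t; reg).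
  replace (1 - 0) with 1 by ring; replace (1 - 1) with 0 by ring.
  repeat split; auto; apply (continuity_comp (fun t => 1 - t)); auto.
Qed.

Lemma path_trans u p q r : path u p q -> path u q r -> path u p r.
Proof.
  intros [g1 [g2 [H1 [H2 [H3 [H4 [H5 [H6 H7]]]]]]]] [h1 [h2 [K1 [K2 [K3 [K4 [K5 [K6 K7]]]]]]]].
  pose (a := fun t => clamp (2 * t)); pose (b := fun t => clamp (2 * t - 1)).
  assert (Ha : continuity a).
  { apply (continuity_comp (fun t => 2 * t) clamp); [intros t; reg|apply continuity_clamp]. }
  assert (Hb : continuity b).
  { apply (continuity_comp (fun t => 2 * t - 1) clamp); [intros t; reg|apply continuity_clamp]. }
  assert (Hc : forall g h c, continuity g -> continuity h ->
    continuity (fun t => g (a t) + h (b t) - c)).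
  { intros g h c Hg Hh; apply continuity_minus; [apply continuity_plus|].
    - apply (continuity_comp a g); auto.
    - apply (continuity_comp b h); auto.
    - apply continuity_const; intros ? ?; auto. }
  (* At every time at least one of the two paths rests at [q], so the sum minus [q] is the
     concatenation, and its continuity needs no gluing. *)
  exists (fun t => g1 (a t) + h1 (b t) - fst q), (fun t => g2 (a t) + h2 (b t) - snd q).
  assert (E : a 0 = 0 /\ b 0 = 0 /\ a 1 = 1 /\ b 1 = 1).
  { unfold a, b; rewrite !clamp_lt0, !clamp_gt1 by lra; auto. }
  destruct E as [-> [-> [-> ->]]].
  repeat split; try (apply Hc; auto); try lra.
  intros t; destruct (Rle_dec t (1/2)) as [Ht|Ht].
  - replace (b t) with 0 by (unfold b; rewrite clamp_lt0; lra).
    rewrite K3, K4; unfold Rminus; rewrite !Rplus_assoc, !Rplus_opp_r, !Rplus_0_r; auto.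
  - replace (a t) with 1 by (unfold a; rewrite clamp_gt1; lra).
    replace (g1 1 + h1 (b t) - fst q) with (h1 (b t)) by lra.
    replace (g2 1 + h2 (b t) - snd q) with (h2 (b t)) by lra; auto.
Qed.

Lemma path_segment (u : R -> R -> R) x y v w :
  (forall t, 0 <= t <= 1 -> u (x + t * v) (y + t * w) <> 0) -> path u (x, y) (x + v, y + w).
Proof.
  intros H; exists (fun t => x + clamp t * v), (fun t => y + clamp t * w).
  assert (Hc : forall a b, continuity (fun t => a + clamp t * b)).
  { intros a b; apply (continuity_comp clamp (fun s => a + s * b));
      [apply continuity_clamp|intros t; reg]. }
  rewrite clamp_lt0, clamp_gt1 by lra; simpl; repeat split; auto; try ring.
  intros t; apply H, clamp_range.
Qed.

Lemma periodic_shift u : periodic u ->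
  forall x y m n, u (x + IZR m) (y + IZR n) = u x y.
Proof.
  intros Hu.
  assert (H1 : forall k x y, u (x + INR k) y = u x y).
  { intros k; induction k as [|k IH]; intros x y; [simpl; now rewrite Rplus_0_r|].
    rewrite S_INR, <- Rplus_assoc, (proj1 (Hu _ _)); auto. }
  assert (H2 : forall k x y, u x (y + INR k) = u x y).
  { intros k; induction k as [|k IH]; intros x y; [simpl; now rewrite Rplus_0_r|].
    rewrite S_INR, <- Rplus_assoc, (proj2 (Hu _ _)); auto. }
  assert (E : forall k : Z, (0 <= k)%Z -> IZR k = INR (Z.to_nat k)).
  { intros k Hk; now rewrite INR_IZR_INZ, Z2Nat.id. }
  assert (H3 : forall m x y, u (x + IZR m) y = u x y).
  { intros m x y; destruct (Z_le_gt_dec 0 m); [rewrite E; auto|].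
    rewrite <- (H1 (Z.to_nat (- m)) (x + IZR m)), <- E, opp_IZR by lia; f_equal; ring. }
  intros x y m n; rewrite H3; destruct (Z_le_gt_dec 0 n); [rewrite E; auto|].
  rewrite <- (H2 (Z.to_nat (- n)) _ (y + IZR n)), <- E, opp_IZR by lia; f_equal; ring.
Qed.

Lemma path_shift u p q m n : periodic u -> path u p q -> path u (shift p m n) (shift q m n).
Proof.
  intros Hu [g1 [g2 [H1 [H2 [H3 [H4 [H5 [H6 H7]]]]]]]].
  exists (fun t => g1 t + IZR m), (fun t => g2 t + IZR n); simpl.
  repeat split; try lra.
  - apply continuity_plus; auto; apply continuity_const; intros ? ?; auto.
  - apply continuity_plus; auto; apply continuity_const; intros ? ?; auto.
  - intros t; rewrite periodic_shift; auto.
Qed.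

Lemma shift_shift p m n m' n' : shift (shift p m n) m' n' = shift p (m + m') (n + n').
Proof. unfold shift; simpl; rewrite !plus_IZR; f_equal; ring. Qed.

Lemma shift_0 p : shift p 0 0 = p.
Proof. unfold shift; rewrite !Rplus_0_r; destruct p; auto. Qed.

Lemma path_nodal u p q : path u p q -> nodal_rel u p q.
Proof. intros H; apply nodal_rel_path; exists 0%Z, 0%Z; now rewrite shift_0. Qed.

Lemma nodal_rel_sym u p q : periodic u -> nodal_rel u p q -> nodal_rel u q p.
Proof.
  intros Hu H; apply nodal_rel_path in H as [m [n H]].
  apply path_sym, (path_shift _ _ _ (- m) (- n) Hu) in H.
  rewrite shift_shift, !Z.add_opp_diag_r, shift_0 in H.
  apply nodal_rel_path; eauto.
Qed.

Lemma nodal_rel_trans u p q r : periodic u ->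
  nodal_rel u p q -> nodal_rel u q r -> nodal_rel u p r.
Proof.
  intros Hu H1 H2; apply nodal_rel_path in H1 as [m [n H1]].
  apply nodal_rel_path in H2 as [m' [n' H2]].
  apply (path_shift _ _ _ m n Hu) in H2; rewrite shift_shift in H2.
  apply nodal_rel_path; exists (m' + m)%Z, (n' + n)%Z; eapply path_trans; eauto.
Qed.

Lemma nodal_rel_shift u p m n : periodic u -> u (fst p) (snd p) <> 0 ->
  nodal_rel u p (shift p m n).
Proof.
  intros Hu H; apply nodal_rel_path; exists (- m)%Z, (- n)%Z.
  rewrite shift_shift, !Z.add_opp_diag_r, shift_0; now apply path_refl.
Qed.

Lemma path_nonzero u p q : path u p q -> u (fst q) (snd q) <> 0.
Proof. intros [g1 [g2 [_ [_ [_ [_ [<- [<- H]]]]]]]]; auto. Qed.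

(** The zero is the supremum of the zero-free stretches that start at [t0]. In [trig1_arcs] the next
    zero serves as a label that tells sample points apart. *)
Lemma first_zero h t0 z0 : continuity h -> h t0 <> 0 -> t0 <= z0 -> h z0 = 0 ->
  exists z, t0 < z /\ h z = 0 /\ forall s, t0 <= s < z -> h s <> 0.
Proof.
  intros Hc H0 Hz Hz0.
  pose (E := fun s => t0 <= s /\ forall r, t0 <= r <= s -> h r <> 0).
  assert (HE0 : E t0) by (split; [lra|intros r Hr; replace r with t0 by lra; auto]).
  destruct (completeness E) as [m [Hm1 Hm2]].
  - exists z0; intros s [Hs1 Hs2]; apply Rnot_lt_le; intros Hlt; apply (Hs2 z0); auto; lra.
  - exists t0; auto.
  - assert (Hbelow : forall s, t0 <= s < m -> h s <> 0).
    { intros s Hs; destruct (classic (exists e, E e /\ s < e)) as [[e [[He1 He2] He]]|Hn].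
      - apply He2; lra.
      - exfalso; apply (Rlt_irrefl s); apply Rlt_le_trans with m; [lra|].
        apply Hm2; intros e He; apply Rnot_lt_le; intros Hse; apply Hn; eauto. }
    pose proof (Hm1 t0 HE0) as Htm.
    assert (Hhm : h m = 0).
    { apply NNPP; intros Hne.
      destruct (continuity_eps_inv h Hc m (Rabs (h m)) (Rabs_pos_lt _ Hne)) as [d [Hd Hnear]].
      assert (HE : E (m + d / 2)).
      { split; [lra|]; intros r Hr Hr0.
        destruct (Rlt_le_dec r m) as [Hrm|Hrm]; [apply (Hbelow r); auto; lra|].
        specialize (Hnear r); rewrite Hr0 in Hnear.
        rewrite Rabs_right in Hnear at 1 by lra.
        specialize (Hnear ltac:(lra)); rewrite Rminus_0_l, Rabs_Ropp in Hnear; lra. }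
      apply Hm1 in HE; lra. }
    exists m; repeat split; auto.
    destruct (Req_dec t0 m) as [<-|Hne]; [contradiction|lra].
Qed.

Lemma trig1_continuity l : continuity (trig1 l).
Proof.
  induction l as [|[[c f] k] l IH].
  - apply continuity_const; intros ? ?; auto.
  - apply (continuity_plus (fun t => c * cos (2 * PI * (IZR k * t) + f)) (trig1 l)); auto.
    intros t; reg.
Qed.

(** Zeros separate any two samples on both arcs of the circle, so each sample has its own next zero
    modulo 1. More than [2 * D] samples would thus give more than [2 * D] zeros and make the
    polynomial vanish everywhere. With [1 <= D], a violation of the bound supplies a second sample,
    hence a zero to start from. *)
Lemma trig1_arcs D l ts :
  (1 <= D)%nat -> (forall c f k, In (c, f, k) l -> (Z.abs k <= Z.of_nat D)%Z) ->
  NoDup ts -> (forall t, In t ts -> trig1 l t <> 0) ->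
  (forall s t, In s ts -> In t ts -> s < t ->
     (exists z, s <= z <= t /\ trig1 l z = 0) /\ (exists z, t <= z <= s + 1 /\ trig1 l z = 0)) ->
  (length ts <= 2 * D)%nat.
Proof.
  intros HD Hk Hd Hnz Hsep; apply Nat.nlt_ge; intros Hlen.
  assert (Hz : forall t, In t ts -> exists z,
    t < z /\ trig1 l z = 0 /\ forall s, t <= s < z -> trig1 l s <> 0).
  { intros t Ht.
    assert (Hs : exists s, In s ts /\ s <> t).
    { destruct ts as [|a [|b ts]]; simpl in Hlen; [lia|lia|].
      destruct (Req_dec a t) as [<-|Ha]; [|exists a; simpl; auto].
      exists b; simpl; split; auto; intros ->.
      inversion Hd; simpl in *; tauto. }
    destruct Hs as [s [Hs Hst]].
    destruct (Rdichotomy s t Hst) as [Hlt|Hlt].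
    - destruct (Hsep s t Hs Ht Hlt) as [_ [z [Hz1 Hz2]]].
      apply first_zero with z; auto using trig1_continuity; lra.
    - destruct (Hsep t s Ht Hs Hlt) as [[z [Hz1 Hz2]] _].
      apply first_zero with z; auto using trig1_continuity; lra. }
  pose (F := fun t => epsilon (inhabits 0) (fun z => t < z /\ trig1 l z = 0 /\
     forall s, t <= s < z -> trig1 l s <> 0)).
  assert (HF : forall t, In t ts -> t < F t /\ trig1 l (F t) = 0 /\
     forall s, t <= s < F t -> trig1 l s <> 0).
  { intros t Ht; unfold F; apply epsilon_spec, Hz, Ht. }
  assert (Hord : forall s t, In s ts -> In t ts -> s < t -> expi (F s) <> expi (F t)).
  { intros s t Hs Ht Hst E; apply expi_inj in E as [k E].
    destruct (HF s Hs) as [Fs1 [Fs2 Fs3]]; destruct (HF t Ht) as [Ft1 [Ft2 Ft3]].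
    destruct (Hsep s t Hs Ht Hst) as [[z [Hz1 Hz2]] [z' [Hz1' Hz2']]].
    assert (F s <= z) by (apply Rnot_lt_le; intros Hlt; apply (Fs3 z); auto; lra).
    assert (F t <= z') by (apply Rnot_lt_le; intros Hlt; apply (Ft3 z'); auto; lra).
    (* [F s <= z <= t < F t] and [F t <= z' <= s + 1 < F s + 1] leave no integer value for
       [k = F s - F t]. *)
    assert (K1 : IZR k < IZR 0) by (simpl; lra); assert (K2 : IZR (-1) < IZR k) by (simpl; lra).
    apply lt_IZR in K1; apply lt_IZR in K2; lia. }
  destruct ts as [|t0 ts']; [simpl in Hlen; lia|].
  apply (Hnz t0); [simpl; auto|].
  apply trig1_roots with D (map F (t0 :: ts')); auto.
  - rewrite map_map; apply NoDup_map_inj; auto; intros s t Hs Ht E.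
    destruct (Rtotal_order s t) as [H|[H|H]]; auto; exfalso.
    + apply (Hord s t); auto.
    + apply (Hord t s); auto.
  - rewrite length_map; auto.
  - intros z Hin; apply in_map_iff in Hin as [t [<- Ht]]; apply HF, Ht.
Qed.

(** * Nodal domains on a closed line *)

Definition waves (l : list (R * R * Z * Z)) (x y : R) : R :=
  fold_right (fun '(c, f, m, n) s => c * cos (2 * PI * (IZR m * x + IZR n * y) + f) + s) 0 l.

Lemma cos_period_Z x k : cos (x + 2 * PI * IZR k) = cos x.
Proof.
  assert (H : forall n x, cos (x + 2 * PI * INR n) = cos x).
  { intros n y; rewrite <- (cos_period y n); f_equal; ring. }
  destruct (Z_le_gt_dec 0 k).
  - rewrite <- (Z2Nat.id k), <- INR_IZR_INZ by lia; auto.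
  - rewrite <- (H (Z.to_nat (- k)) (x + _)), INR_IZR_INZ, Z2Nat.id, opp_IZR by lia; f_equal; ring.
Qed.

Lemma waves_periodic l : periodic (waves l).
Proof.
  intros x y; induction l as [|[[[c f] m] n] l [IH1 IH2]]; [split; auto|].
  split; simpl; f_equal; auto; f_equal.
  - rewrite <- (cos_period_Z (2 * PI * (IZR m * x + IZR n * y) + f) m); f_equal; ring.
  - rewrite <- (cos_period_Z (2 * PI * (IZR m * x + IZR n * y) + f) n); f_equal; ring.
Qed.

Lemma waves_line l x0 y0 v w t :
  waves l (x0 + t * IZR v) (y0 + t * IZR w) =
  trig1 (map (fun '(c, f, m, n) => (c, 2 * PI * (IZR m * x0 + IZR n * y0) + f, (m * v + n * w)%Z)) l) t.
Proof.
  induction l as [|[[[c f] m] n] l IH]; simpl; auto.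
  rewrite IH, plus_IZR, !mult_IZR; f_equal; f_equal; f_equal; ring.
Qed.

(** A zero-free segment of the line is itself a path, so points of the line in different nodal
    domains are separated by zeros on it. One parameter per domain then satisfies [trig1_arcs]. *)
Lemma line_count l D v w x0 y0 (P : nat -> R * R) (I : list nat) :
  (1 <= D)%nat ->
  (forall c f m n, In (c, f, m, n) l -> (Z.abs (m * v + n * w) <= Z.of_nat D)%Z) ->
  NoDup I ->
  (forall i j, In i I -> In j I -> i <> j -> ~ nodal_rel (waves l) (P i) (P j)) ->
  (forall i, In i I -> exists t, waves l (x0 + t * IZR v) (y0 + t * IZR w) <> 0 /\
     nodal_rel (waves l) (P i) (x0 + t * IZR v, y0 + t * IZR w)) ->
  (length I <= 2 * D)%nat.
Proof.
  intros HD Hk Hd Hsep Hmeet.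
  set (u := waves l) in *.
  assert (Hu : periodic u) by apply waves_periodic.
  pose (Q := fun i t => 0 <= t < 1 /\ u (x0 + t * IZR v) (y0 + t * IZR w) <> 0 /\
     nodal_rel u (P i) (x0 + t * IZR v, y0 + t * IZR w)).
  pose (T := fun i => epsilon (inhabits 0) (Q i)).
  assert (HT : forall i, In i I -> Q i (T i)).
  { intros i Hi; apply epsilon_spec.
    destruct (Hmeet i Hi) as [t [Ht1 Ht2]].
    (* Since [v] and [w] are integers, removing the integer part of the parameter moves the point by
       a lattice vector and keeps it in the same nodal domain. *)
    destruct (archimed t) as [A1 A2]; set (k := (up t - 1)%Z).
    assert (Hk' : IZR k = IZR (up t) - 1) by (unfold k; rewrite minus_IZR; auto).
    assert (E : forall z b, z + (t - IZR k) * IZR b = z + t * IZR b + IZR (- k * b))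
      by (intros; rewrite mult_IZR, opp_IZR; ring).
    exists (t - IZR k); split; [lra|]; rewrite !E; split.
    - rewrite periodic_shift; auto.
    - apply nodal_rel_trans with (1 := Hu) (2 := Ht2).
      apply (nodal_rel_shift u (x0 + t * IZR v, y0 + t * IZR w)); auto. }
  assert (Hseg : forall i j s t, In i I -> In j I -> i <> j ->
    nodal_rel u (P i) (x0 + s * IZR v, y0 + s * IZR w) ->
    nodal_rel u (P j) (x0 + t * IZR v, y0 + t * IZR w) -> s <= t ->
    exists z, s <= z <= t /\ u (x0 + z * IZR v) (y0 + z * IZR w) = 0).
  { intros i j s t Hi Hj Hij Hs Ht Hst; apply NNPP; intros Hn.
    apply (Hsep i j Hi Hj Hij).
    apply nodal_rel_trans with (1 := Hu) (2 := Hs).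
    apply nodal_rel_trans with (x0 + t * IZR v, y0 + t * IZR w); auto; [|now apply nodal_rel_sym].
    apply path_nodal.
    replace (x0 + t * IZR v) with (x0 + s * IZR v + (t - s) * IZR v) by ring.
    replace (y0 + t * IZR w) with (y0 + s * IZR w + (t - s) * IZR w) by ring.
    apply path_segment; intros r Hr H0; apply Hn; exists (s + r * (t - s)); split; [nra|].
    rewrite <- H0; f_equal; ring. }
  rewrite <- (length_map T).
  pose proof (waves_line l x0 y0 v w) as HL; set (l1 := map _ l) in HL.
  apply (trig1_arcs D l1); auto.
  - intros c f k Hin; apply in_map_iff in Hin as [[[[c' f'] m] n] [E Hin]]; injection E as <- <- <-; eauto.
  - apply NoDup_map_inj; auto; intros i j Hi Hj E; apply NNPP; intros Hij.
    apply (Hsep i j Hi Hj Hij).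
    destruct (HT i Hi) as [_ [_ Hi']]; destruct (HT j Hj) as [_ [_ Hj']].
    rewrite E in Hi'; apply nodal_rel_trans with (1 := Hu) (2 := Hi'), nodal_rel_sym; auto.
  - intros t Ht; apply in_map_iff in Ht as [i [<- Hi]]; rewrite <- HL; apply HT, Hi.
  - intros s t Hs Ht Hst; apply in_map_iff in Hs as [i [Es Hi]].
    apply in_map_iff in Ht as [j [Et Hj]].
    assert (Hij : i <> j) by (intros ->; lra).
    destruct (HT i Hi) as [Hi1 [Hi2 Hi3]]; destruct (HT j Hj) as [Hj1 [Hj2 Hj3]].
    rewrite Es in *; rewrite Et in *; split.
    + destruct (Hseg i j s t) as [z [Hz1 Hz2]]; auto; [lra|].
      exists z; split; auto; rewrite <- Hz2; symmetry; apply HL.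
    (* The other arc, from [t] to [s + 1]: the point at [s + 1] is a lattice translate of the point
       at [s]. *)
    + assert (E : forall z b, z + (s + 1) * IZR b = z + s * IZR b + IZR b) by (intros; ring).
      destruct (Hseg j i t (s + 1)) as [z [Hz1 Hz2]]; auto; [|lra|].
      * rewrite !E; apply nodal_rel_trans with (1 := Hu) (2 := Hi3).
        apply (nodal_rel_shift u (x0 + s * IZR v, y0 + s * IZR w)); auto.
      * exists z; split; auto; rewrite <- Hz2; symmetry; apply HL.
Qed.

(** * Barta's inequality in a rectangle *)

Lemma min_second_derivative g g' x0 g2 d : 0 < d ->
  (forall x, derivable_pt_lim g x (g' x)) -> derivable_pt_lim g' x0 g2 ->
  (forall x, Rabs (x - x0) < d -> g x0 <= g x) -> 0 <= g2.
Proof.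
  intros Hd H1 H2 Hmin; apply Rnot_lt_le; intros Hneg.
  assert (H0 : g' x0 = 0).
  { pose (pr := exist (fun l => derivable_pt_lim g x0 l) (g' x0) (H1 x0) : derivable_pt g x0).
    change (derive_pt g x0 pr = 0).
    apply deriv_minimum with (x0 - d) (x0 + d); try lra.
    intros x Hx1 Hx2; apply Hmin, Rabs_def1; lra. }
  destruct (H2 (- g2 / 2) ltac:(lra)) as [e He].
  pose (h := Rmin d e / 2).
  assert (Hh : 0 < h /\ h < d /\ h < e).
  { unfold h; destruct e as [e He0]; simpl in *; unfold Rmin; destruct Rle_dec; lra. }
  destruct (MVT_cor2 g g' x0 (x0 + h) ltac:(lra) (fun c _ => H1 c)) as [c [Hc1 Hc2]].
  assert (Hgc : g' c < 0).
  { specialize (He (c - x0) ltac:(lra) ltac:(rewrite Rabs_right; lra)).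
    replace (x0 + (c - x0)) with c in He by ring; rewrite H0, Rminus_0_r in He.
    apply Rabs_def2 in He.
    assert (Hq : g' c / (c - x0) < 0) by lra.
    replace (g' c) with (g' c / (c - x0) * (c - x0)) by (field; lra); nra. }
  specialize (Hmin (x0 + h) ltac:(rewrite Rabs_right; lra)).
  assert (g' c * (x0 + h - x0) < 0) by nra; lra.
Qed.

(** Compactness enters through [gauge], used twice: with [1 / (1 + |f|)] it bounds [f] above, and
    with [S - f], positive if the supremum [S] is not attained, it would give a smaller upper bound
    than [S]. *)
Lemma usc_max (f : R -> R -> R) a b c d : a <= b -> c <= d ->
  (forall x y, a <= x <= b -> c <= y <= d -> forall eps, 0 < eps -> exists r, 0 < r /\
     forall x' y', a <= x' <= b -> c <= y' <= d -> Rabs (x' - x) < r -> Rabs (y' - y) < r ->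
       f x' y' < f x y + eps) ->
  exists x y, a <= x <= b /\ c <= y <= d /\
    forall x' y', a <= x' <= b -> c <= y' <= d -> f x' y' <= f x y.
Proof.
  intros Hab Hcd Husc.
  (* A gauge [delta] that controls [f] nearby and is itself at most [g u v] turns a positive
     lower bound of [delta] into one of [g]. *)
  assert (gauge : forall (h g : R -> R -> R),
    (forall x y, a <= x <= b -> c <= y <= d -> f x y < h x y /\ 0 < g x y) ->
    exists e, 0 < e /\ forall x y, a <= x <= b -> c <= y <= d ->
      exists u v, a <= u <= b /\ c <= v <= d /\ f x y < h u v /\ e <= g u v).
  { intros h g Hhg.
    assert (Hr : forall u v, exists r : posreal, a <= u <= b -> c <= v <= d ->
      r <= g u v /\ forall x y, a <= x <= b -> c <= y <= d ->
        Rabs (x - u) < r -> Rabs (y - v) < r -> f x y < h u v).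
    { intros u v; destruct (classic (a <= u <= b /\ c <= v <= d)) as [[Hu Hv]|Hn].
      - destruct (Hhg u v Hu Hv) as [Hf Hg].
        destruct (Husc u v Hu Hv (h u v - f u v) ltac:(lra)) as [r [Hr Hr']].
        assert (Hm : 0 < Rmin r (g u v)) by (apply Rmin_pos; auto).
        exists (mkposreal _ Hm); simpl; intros _ _; split; [apply Rmin_r|].
        intros x y Hx Hy Hxu Hyv; pose proof (Rmin_l r (g u v)).
        specialize (Hr' x y Hx Hy ltac:(lra) ltac:(lra)); lra.
      - exists (mkposreal 1 Rlt_0_1); intros Hu Hv; exfalso; auto. }
    pose (delta := fun u v => proj1_sig (constructive_indefinite_description _ (Hr u v))).
    assert (Hdelta : forall u v, a <= u <= b -> c <= v <= d ->
      delta u v <= g u v /\ forall x y, a <= x <= b -> c <= y <= d ->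
        Rabs (x - u) < delta u v -> Rabs (y - v) < delta u v -> f x y < h u v).
    { intros u v; unfold delta; destruct constructive_indefinite_description as [r Hr0]; auto. }
    destruct (compactness_value_2d a b c d delta) as [e He].
    exists e; split; [apply cond_pos|]; intros x y Hx Hy.
    apply NNPP; intros Hn; apply (He x y Hx Hy); intros [u [v [Hu [Hv [H1 [H2 H3]]]]]].
    destruct (Hdelta u v Hu Hv) as [H4 H5]; apply Hn; exists u, v.
    repeat split; try tauto; [apply H5; auto|lra]. }
  pose (E := fun s => exists x y, a <= x <= b /\ c <= y <= d /\ s = f x y).
  destruct (completeness E) as [S [HS1 HS2]].
  - destruct (gauge (fun u v => f u v + 1) (fun u v => / (1 + Rabs (f u v))))
      as [e [He Hg]].
    { intros x y _ _; split; [lra|].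
      apply Rinv_0_lt_compat; pose proof (Rabs_pos (f x y)); lra. }
    exists (/ e + 1); intros s [x [y [Hx [Hy ->]]]].
    destruct (Hg x y Hx Hy) as [u [v [_ [_ [H1 H2]]]]].
    apply Rinv_le_contravar in H2; auto; rewrite Rinv_inv in H2.
    pose proof (Rle_abs (f u v)); lra.
  - exists (f a c), a, c; repeat split; lra.
  - apply NNPP; intros Hn.
    assert (Hlt : forall x y, a <= x <= b -> c <= y <= d -> f x y < S).
    { intros x y Hx Hy; destruct (HS1 (f x y)) as [Hlt|Heq]; [exists x, y; auto|auto|].
      exfalso; apply Hn; exists x, y; rewrite Heq; repeat split; try tauto.
      intros; apply HS1; do 2 eexists; eauto. }
    destruct (gauge (fun u v => (S + f u v) / 2) (fun u v => S - f u v)) as [e [He Hg]].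
    { intros x y Hx Hy; specialize (Hlt x y Hx Hy); lra. }
    assert (S <= S - e / 2); [|lra].
    apply HS2; intros s [x [y [Hx [Hy ->]]]].
    destruct (Hg x y Hx Hy) as [u [v [_ [_ [H1 H2]]]]]; lra.
Qed.

Lemma waves_derive_x l y : exists g1 g2 : R -> R,
  (forall x, derivable_pt_lim (fun x => waves l x y) x (g1 x)) /\
  (forall x, derivable_pt_lim g1 x (g2 x)) /\
  (forall x, g2 x = fold_right (fun '(c, f, m, n) s =>
     - (2 * PI * IZR m)^2 * (c * cos (2 * PI * (IZR m * x + IZR n * y) + f)) + s) 0 l).
Proof.
  induction l as [|[[[c f] m] n] l [g1 [g2 [H1 [H2 H3]]]]].
  - exists (fun _ => 0), (fun _ => 0); repeat split; auto; intros; apply derivable_pt_lim_const.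
  - exists (fun x => c * (- sin (2 * PI * (IZR m * x + IZR n * y) + f) * (2 * PI * IZR m)) + g1 x),
      (fun x => - (2 * PI * IZR m)^2 * (c * cos (2 * PI * (IZR m * x + IZR n * y) + f)) + g2 x).
    repeat split; intros x.
    + apply (derivable_pt_lim_plus (fun x => c * cos (2 * PI * (IZR m * x + IZR n * y) + f))
        (fun x => waves l x y)); auto.
      apply is_derive_Reals; auto_derive; auto; ring.
    + apply (derivable_pt_lim_plus
        (fun x => c * (- sin (2 * PI * (IZR m * x + IZR n * y) + f) * (2 * PI * IZR m))) g1); auto.
      apply is_derive_Reals; auto_derive; auto; ring.
    + simpl; now rewrite H3.
Qed.

Lemma waves_swap l x y :
  waves l x y = waves (map (fun '(c, f, m, n) => (c, f, n, m)) l) y x.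
Proof.
  induction l as [|[[[c f] m] n] l IH]; simpl; auto.
  rewrite IH, (Rplus_comm (IZR m * x)); auto.
Qed.

Lemma waves_derive_y l x : exists g1 g2 : R -> R,
  (forall y, derivable_pt_lim (fun y => waves l x y) y (g1 y)) /\
  (forall y, derivable_pt_lim g1 y (g2 y)) /\
  (forall y, g2 y = fold_right (fun '(c, f, m, n) s =>
     - (2 * PI * IZR n)^2 * (c * cos (2 * PI * (IZR m * x + IZR n * y) + f)) + s) 0 l).
Proof.
  destruct (waves_derive_x (map (fun '(c, f, m, n) => (c, f, n, m)) l) x) as [g1 [g2 [H1 [H2 H3]]]].
  exists g1, g2; repeat split; auto.
  - intros y; apply is_derive_Reals; eapply is_derive_ext; [intros t; symmetry; apply waves_swap|].
    apply is_derive_Reals, H1.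
  - intros y; rewrite H3; clear.
    induction l as [|[[[c f] m] n] l IH]; cbn [map fold_right]; auto.
    rewrite IH, (Rplus_comm (IZR n * y)); auto.
Qed.

Lemma waves_continuity_2d l x y : continuity_2d_pt (waves l) x y.
Proof.
  induction l as [|[[[c f] m] n] l IH]; [apply continuity_2d_pt_const|].
  apply (continuity_2d_pt_plus (fun x y => c * cos (2 * PI * (IZR m * x + IZR n * y) + f))); auto.
  apply (continuity_1d_2d_pt_comp (fun z => c * cos (2 * PI * z + f))
    (fun x y => IZR m * x + IZR n * y)).
  - reg.
  - apply continuity_2d_pt_plus; apply continuity_2d_pt_mult;
      auto using continuity_2d_pt_const, continuity_2d_pt_id1, continuity_2d_pt_id2.
Qed.

Lemma path_near l x y : waves l x y <> 0 -> exists d, 0 < d /\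
  forall x' y', Rabs (x' - x) < d -> Rabs (y' - y) < d -> path (waves l) (x, y) (x', y').
Proof.
  intros H; destruct (waves_continuity_2d l x y (mkposreal _ (Rabs_pos_lt _ H))) as [d Hd].
  exists d; split; [apply cond_pos|]; intros x' y' Hx Hy.
  replace x' with (x + (x' - x)) by ring; replace y' with (y + (y' - y)) by ring.
  apply path_segment; intros t Ht H0.
  assert (Hsc : forall z, Rabs (t * z) <= Rabs z).
  { intros z; rewrite Rabs_mult, (Rabs_right t) by lra.
    pose proof (Rabs_pos z); nra. }
  specialize (Hd (x + t * (x' - x)) (y + t * (y' - y))).
  replace (x + t * (x' - x) - x) with (t * (x' - x)) in Hd by ring.
  replace (y + t * (y' - y) - y) with (t * (y' - y)) in Hd by ring.
  rewrite H0 in Hd; simpl in Hd.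
  specialize (Hd (Rle_lt_trans _ _ _ (Hsc _) Hx) (Rle_lt_trans _ _ _ (Hsc _) Hy)).
  rewrite Rminus_0_l, Rabs_Ropp in Hd; lra.
Qed.

Lemma waves_scale l s x y :
  waves (map (fun '(c, f, m, n) => (s * c, f, m, n)) l) x y = s * waves l x y.
Proof.
  induction l as [|[[[c f] m] n] l IH]; simpl; [ring|rewrite IH; ring].
Qed.

(* Barta's argument: if the bound failed, [s(x,y) = sin sin] adapted to a slightly larger rectangle
   would be positive on the closure of the nodal domain with [-Delta s / s > -Delta u / u],
   which the second derivative test excludes at a maximum of [u / s]. *)
Lemma barta_pos l M x0 y0 a1 b1 a2 b2 :
  (forall c f m n, In (c, f, m, n) l -> (m * m + n * n = M)%Z) ->
  0 < waves l x0 y0 -> a1 < b1 -> a2 < b2 ->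
  (forall x y, path (waves l) (x0, y0) (x, y) -> a1 <= x <= b1 /\ a2 <= y <= b2) ->
  / (b1 - a1)^2 + / (b2 - a2)^2 <= 4 * IZR M.
Proof.
  intros HM Hp Hab1 Hab2 Hbox; apply Rnot_lt_le; intros Hlt.
  set (u := waves l) in *.
  assert (HM0 : 0 <= IZR M).
  { destruct l as [|[[[c f] m] n] l]; [unfold u in Hp; simpl in Hp; lra|].
    rewrite <- (HM c f m n), plus_IZR, !mult_IZR by (simpl; auto); nra. }
  set (a := b1 - a1) in *; set (b := b2 - a2) in *.
  assert (Ha : 0 < a) by (unfold a; lra); assert (Hb : 0 < b) by (unfold b; lra).
  set (K := / a^2 + / b^2) in *.
  assert (Hd : exists d, 0 < d /\ 4 * IZR M * (1 + d)^2 < K).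
  (* For [d <= 1], [(1 + d)^2 <= 1 + 3 * d], whence [12 = 4 * 3]; the added 1 keeps the denominator
     positive and the inequality strict. *)
  { pose (e := (K - 4 * IZR M) / (12 * IZR M + 1)).
    assert (He : 0 < e) by (apply Rdiv_lt_0_compat; lra).
    assert (He' : e * (12 * IZR M + 1) = K - 4 * IZR M) by (unfold e; field; lra).
    exists (Rmin 1 e); assert (H1 := Rmin_l 1 e); assert (H2 := Rmin_r 1 e).
    assert (H3 : 0 < Rmin 1 e) by (apply Rmin_pos; lra).
    set (d := Rmin 1 e) in *; split; auto.
    assert (d * d <= d) by nra.
    assert (IZR M * (d * d) <= IZR M * d) by nra.
    assert (IZR M * d <= IZR M * e) by nra.
    nra. }
  destruct Hd as [d [Hd HdK]].
  (* The enlarged rectangle has sides [a * (1 + d)], [b * (1 + d)] and the same centre, so the sine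
     product stays positive on the closed box, and [-Delta s = (PI^2 * K / (1 + d)^2) * s]. *)
  pose (w1 := PI / (a * (1 + d))); pose (w2 := PI / (b * (1 + d))).
  pose (s := fun x y => sin (w1 * (x - a1 + d * a / 2)) * sin (w2 * (y - a2 + d * b / 2))).
  assert (PIp := PI_RGT_0).
  assert (Hsin : forall c z, 0 < c -> 0 <= z <= c -> 0 < sin (PI / (c * (1 + d)) * (z + d * c / 2))).
  { intros c z Hc Hz; assert (Hcd : 0 < c * (1 + d)) by nra.
    assert (H1 : 0 < (z + d * c / 2) / (c * (1 + d))) by (apply Rdiv_lt_0_compat; nra).
    assert (H2 : (z + d * c / 2) / (c * (1 + d)) < 1).
    { apply Rmult_lt_reg_r with (c * (1 + d)); auto.
      unfold Rdiv; rewrite Rmult_assoc, Rinv_l by lra; nra. }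
    replace (PI / (c * (1 + d)) * (z + d * c / 2)) with (PI * ((z + d * c / 2) / (c * (1 + d))))
      by (field; lra).
    apply sin_gt_0; nra. }
  assert (Hs : forall x y, a1 <= x <= b1 -> a2 <= y <= b2 -> 0 < s x y).
  { intros x y Hx Hy; unfold s; apply Rmult_lt_0_compat; apply Hsin; unfold a, b; lra. }
  assert (Hsc : forall x y, continuity_2d_pt s x y).
  { intros x y; apply (continuity_2d_pt_mult (fun x y => sin (w1 * (x - a1 + d * a / 2)))
      (fun x y => sin (w2 * (y - a2 + d * b / 2)))).
    - apply (continuity_1d_2d_pt_comp (fun z => sin (w1 * (z - a1 + d * a / 2))) (fun x y => x));
        [reg|apply continuity_2d_pt_id1].
    - apply (continuity_1d_2d_pt_comp (fun z => sin (w2 * (z - a2 + d * b / 2))) (fun x y => y));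
        [reg|apply continuity_2d_pt_id2]. }
  (* [u / s] is cut off to 0 outside the component. On the boundary [u = 0], so [q = 0] there and
     the cut-off function remains upper semicontinuous. *)
  pose (q := fun x y => Rmax 0 (u x y / s x y)).
  pose (F := fun x y => if excluded_middle_informative (path u (x0, y0) (x, y)) then q x y else 0).
  assert (HFq : forall x y, F x y <= q x y).
  { intros x y; unfold F, q; destruct excluded_middle_informative; [lra|apply Rmax_l]. }
  assert (Hqc : forall x y, a1 <= x <= b1 -> a2 <= y <= b2 -> forall eps, 0 < eps ->
    exists r, 0 < r /\ forall x' y', Rabs (x' - x) < r -> Rabs (y' - y) < r -> q x' y' < q x y + eps).
  { intros x y Hx Hy eps Heps.
    assert (Hc : continuity_2d_pt (fun x y => u x y / s x y) x y).
    { apply (continuity_2d_pt_mult u (fun x y => / s x y)); [apply waves_continuity_2d|].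
      apply continuity_2d_pt_inv; auto; specialize (Hs x y Hx Hy); lra. }
    destruct (Hc (mkposreal eps Heps)) as [r Hr]; exists r; split; [apply cond_pos|].
    intros x' y' Hx' Hy'; specialize (Hr x' y' Hx' Hy'); simpl in Hr; apply Rabs_def2 in Hr.
    unfold q, Rmax; repeat destruct Rle_dec; lra. }
  destruct (usc_max F a1 b1 a2 b2) as [xm [ym [Hxm [Hym Hmax]]]]; try lra.
  { intros x y Hx Hy eps Heps.
    destruct (classic (u x y <> 0 /\ ~ path u (x0, y0) (x, y))) as [[H1 H2]|H].
    - destruct (path_near l x y H1) as [r [Hr Hpath]]; exists r; split; auto.
      intros x' y' _ _ Hx' Hy'; unfold F.
      destruct (excluded_middle_informative (path u (x0, y0) (x', y'))) as [Hp'|_].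
      + exfalso; apply H2; apply path_trans with (1 := Hp'), path_sym, Hpath; auto.
      + destruct excluded_middle_informative; [contradiction|lra].
    - assert (E : F x y = q x y).
      { unfold F; destruct excluded_middle_informative as [_|Hn]; auto.
        assert (E : u x y = 0) by (apply NNPP; auto).
        unfold q; rewrite E; unfold Rdiv; rewrite Rmult_0_l, Rmax_left; lra. }
      destruct (Hqc x y Hx Hy eps Heps) as [r [Hr Hr']]; exists r; split; auto.
      intros x' y' _ _ Hx' Hy'; rewrite E.
      apply Rle_lt_trans with (1 := HFq x' y'); auto. }
  set (W := F xm ym) in *.
  destruct (Hbox x0 y0) as [Hx0 Hy0]; [apply path_refl; simpl; unfold u in *; lra|].
  assert (HW : 0 < W).
  { apply Rlt_le_trans with (2 := Hmax x0 y0 Hx0 Hy0); unfold F.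
    destruct excluded_middle_informative as [_|Hn].
    - apply Rlt_le_trans with (2 := Rmax_r _ _), Rdiv_lt_0_compat; auto.
    - exfalso; apply Hn, path_refl; simpl; lra. }
  assert (Hsm := Hs xm ym Hxm Hym).
  assert (Hpm : path u (x0, y0) (xm, ym) /\ u xm ym = W * s xm ym).
  { revert HW; unfold W, F; destruct excluded_middle_informative as [Hpm|_]; [|lra].
    intros HW; split; auto; revert HW; unfold q, Rmax; destruct Rle_dec; [|lra].
    intros _; field; lra. }
  destruct Hpm as [Hpm Hum].
  destruct (path_near l xm ym) as [r [Hr Hnear]]; [fold u; rewrite Hum; nra|].
  (* A neighbourhood of the maximum lies in the nodal domain, hence in the box, so a maximum on an
     edge needs no separate treatment. [W * s - u] has a local minimum there, of value 0. *)
  assert (Hdom : forall x y, Rabs (x - xm) < r -> Rabs (y - ym) < r -> u x y <= W * s x y).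
  { intros x y Hx Hy.
    assert (Hpxy : path u (x0, y0) (x, y)) by (apply path_trans with (1 := Hpm), Hnear; auto).
    destruct (Hbox x y Hpxy) as [Hx' Hy'].
    specialize (Hmax x y Hx' Hy'); specialize (Hs x y Hx' Hy').
    unfold F at 1 in Hmax; destruct excluded_middle_informative; [|contradiction].
    assert (Hq : u x y / s x y <= W) by (apply Rle_trans with (2 := Hmax), Rmax_r).
    apply Rmult_le_compat_r with (r := s x y) in Hq; [|lra].
    unfold Rdiv in Hq; rewrite Rmult_assoc, Rinv_l in Hq; lra. }
  assert (H0r : Rabs (xm - xm) < r /\ Rabs (ym - ym) < r) by (rewrite !Rminus_diag, Rabs_R0; auto).
  destruct (waves_derive_x l ym) as [gx [gxx [Hgx [Hgxx Egxx]]]].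
  destruct (waves_derive_y l xm) as [gy [gyy [Hgy [Hgyy Egyy]]]].
  assert (Hxx : 0 <= - w1^2 * (W * s xm ym) - gxx xm).
  { apply (min_second_derivative (fun x => W * s x ym - u x ym)
      (fun x => W * (w1 * cos (w1 * (x - a1 + d * a / 2)) * sin (w2 * (ym - a2 + d * b / 2))) - gx x)
      xm _ r Hr).
    - intros x; apply (derivable_pt_lim_minus (fun x => W * s x ym) (fun x => u x ym)); auto.
      apply is_derive_Reals; unfold s; auto_derive; auto; unfold Rminus; ring.
    - apply (derivable_pt_lim_minus
        (fun x => W * (w1 * cos (w1 * (x - a1 + d * a / 2)) * sin (w2 * (ym - a2 + d * b / 2)))) gx);
        auto.
      apply is_derive_Reals; unfold s; auto_derive; auto; unfold Rminus; ring.
    - intros x Hx; rewrite Hum, Rminus_diag; specialize (Hdom x ym Hx (proj2 H0r)); lra. }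
  assert (Hyy : 0 <= - w2^2 * (W * s xm ym) - gyy ym).
  { apply (min_second_derivative (fun y => W * s xm y - u xm y)
      (fun y => W * (sin (w1 * (xm - a1 + d * a / 2)) * (w2 * cos (w2 * (y - a2 + d * b / 2)))) - gy y)
      ym _ r Hr).
    - intros y; apply (derivable_pt_lim_minus (fun y => W * s xm y) (fun y => u xm y)); auto.
      apply is_derive_Reals; unfold s; auto_derive; auto; unfold Rminus; ring.
    - apply (derivable_pt_lim_minus
        (fun y => W * (sin (w1 * (xm - a1 + d * a / 2)) * (w2 * cos (w2 * (y - a2 + d * b / 2))))) gy);
        auto.
      apply is_derive_Reals; unfold s; auto_derive; auto; unfold Rminus; ring.
    - intros y Hy; rewrite Hum, Rminus_diag; specialize (Hdom xm y (proj1 H0r) Hy); lra. }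
  assert (Hlap : gxx xm + gyy ym = - 4 * PI^2 * IZR M * u xm ym).
  { rewrite Egxx, Egyy; unfold u; clear - HM; induction l as [|[[[c f] m] n] l IH]; simpl; [ring|].
    specialize (IH (fun c f m n H => HM c f m n (or_intror H))).
    pose proof (f_equal IZR (HM c f m n (or_introl eq_refl))) as E.
    rewrite plus_IZR, !mult_IZR in E; rewrite <- E in *; simpl in IH; lra. }
  rewrite Hum in Hlap.
  assert (HT : 0 < W * s xm ym) by nra.
  set (T := W * s xm ym) in *.
  assert (Hw : w1^2 + w2^2 = PI^2 * K / (1 + d)^2) by (unfold w1, w2, K; field; lra).
  assert (Hfin : 0 <= (4 * PI^2 * IZR M - PI^2 * K / (1 + d)^2) * T) by (rewrite <- Hw; nra).
  assert (Hd2 : 0 < (1 + d)^2) by nra.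
  assert (Hk : 4 * IZR M < K / (1 + d)^2).
  { apply Rmult_lt_reg_r with ((1 + d)^2); auto.
    replace (K / (1 + d)^2 * (1 + d)^2) with K by (field; lra); lra. }
  assert (HPI2 : 0 < PI^2) by nra.
  assert (4 * PI^2 * IZR M - PI^2 * K / (1 + d)^2 < 0).
  { replace (PI^2 * K / (1 + d)^2) with (PI^2 * (K / (1 + d)^2)) by (field; lra); nra. }
  nra.
Qed.

Lemma barta l M x0 y0 a1 b1 a2 b2 :
  (forall c f m n, In (c, f, m, n) l -> (m * m + n * n = M)%Z) ->
  waves l x0 y0 <> 0 -> a1 < b1 -> a2 < b2 ->
  (forall x y, path (waves l) (x0, y0) (x, y) -> a1 <= x <= b1 /\ a2 <= y <= b2) ->
  / (b1 - a1)^2 + / (b2 - a2)^2 <= 4 * IZR M.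
Proof.
  intros HM Hne H1 H2 Hbox.
  destruct (Rlt_le_dec 0 (waves l x0 y0)) as [Hp|Hn]; [eapply barta_pos; eauto|].
  pose (l' := map (fun '(c, f, m, n) => (-1 * c, f, m, n)) l : list (R * R * Z * Z)).
  assert (E : forall x y, waves l' x y = -1 * waves l x y) by (intros; apply waves_scale).
  apply barta_pos with l' x0 y0; auto.
  - intros c f m n Hin; apply in_map_iff in Hin as [[[[c' f'] m'] n'] [Eq Hin]].
    injection Eq as _ _ <- <-; eauto.
  - rewrite E; lra.
  - intros x y [g1 [g2 Hg]]; apply Hbox; exists g1, g2; repeat (split; try tauto).
    destruct Hg as [_ [_ [_ [_ [_ [_ Hg]]]]]]; intros t Ht; apply (Hg t); rewrite E, Ht; ring.
Qed.

(** * Counting nodal domains *)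

Definition lin (p q : Z) (z : R * R) : R := IZR p * fst z + IZR q * snd z.

(** By intermediate values the path crosses the level; stopped at that time, it still joins [P] to
    the crossing point. *)
Lemma path_level u P Q p q c : path u P Q ->
  lin p q P <= c <= lin p q Q \/ lin p q Q <= c <= lin p q P ->
  exists z, path u P z /\ lin p q z = c.
Proof.
  intros [g1 [g2 [H1 [H2 [H3 [H4 [H5 [H6 H7]]]]]]]] Hc.
  pose (h := fun t => IZR p * g1 t + IZR q * g2 t).
  assert (Hh : continuity h).
  { apply continuity_plus; apply continuity_mult; auto; apply continuity_const; intros ? ?; auto. }
  assert (E : exists t, h t = c).
  { destruct (IVT_gen h 0 1 c) as [t [_ Ht]].
    - exact Hh.
    - unfold h; rewrite H3, H4, H5, H6; unfold lin in Hc.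
      unfold Rmin, Rmax; destruct Rle_dec; lra.
    - eauto. }
  destruct E as [t Ht]; exists (g1 t, g2 t); split; [|exact Ht].
  assert (Hs : continuity (fun s => s * t)) by (intros s; reg).
  exists (fun s => g1 (s * t)), (fun s => g2 (s * t)); simpl.
  rewrite Rmult_0_l, Rmult_1_l; repeat split; auto;
    [apply (continuity_comp (fun s => s * t) g1)|apply (continuity_comp (fun s => s * t) g2)]; auto.
Qed.

Lemma longest_run (M : nat -> Prop) K : exists t, (t <= K)%nat /\
  (forall i, (i < t)%nat -> M i) /\ (t = K \/ ~ M t).
Proof.
  induction K as [|K [t [H1 [H2 H3]]]].
  - exists 0%nat; repeat split; auto; intros; lia.
  - destruct (Nat.eq_dec t K) as [->|Hne].
    + destruct (classic (M K)) as [HM|HM].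
      * exists (S K); repeat split; auto; intros i Hi.
        destruct (Nat.eq_dec i K) as [->|]; auto; apply H2; lia.
      * exists K; repeat split; auto.
    + exists t; repeat split; auto; destruct H3; auto; contradiction.
Qed.

Lemma list_sum_exchange {A B : Type} (f : A -> B -> bool) (I : list A) (J : list B) :
  list_sum (map (fun i => length (filter (f i) J)) I) =
  list_sum (map (fun j => length (filter (fun i => f i j) I)) J).
Proof.
  induction I as [|i I IH]; simpl.
  - induction J; simpl; auto.
  - rewrite IH; clear IH; induction J as [|j J IH]; simpl; auto.
    destruct (f i j); simpl; rewrite <- IH; lia.
Qed.

Lemma list_sum_le {A : Type} (f : A -> nat) c (I : list A) :
  (forall i, In i I -> (f i <= c)%nat) -> (list_sum (map f I) <= length I * c)%nat.
Proof.
  induction I as [|i I IH]; simpl; intros H; auto.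
  specialize (IH (fun j Hj => H j (or_intror Hj))); specialize (H i (or_introl eq_refl)); lia.
Qed.

Section Sampling.

Variable (u : R -> R -> R) (p q : Z) (K : nat).

Definition meets (P : R * R) (j : Z) : Prop :=
  exists z, path u P z /\ lin p q z = IZR j / INR K.

(** For coprime [p], [q], lines whose levels differ by an integer have the same image in the torus.
    Level indices therefore count modulo [K], while [meets] refers to the component in the plane. *)
Definition hit (P : R * R) (r : Z) : bool :=
  if excluded_middle_informative (exists w, meets P (r + Z.of_nat K * w)) then true else false.

Definition residues : list Z := map Z.of_nat (seq 0 K).

Definition hits (P : R * R) : nat := length (filter (hit P) residues).

Lemma hits_run P j0 L : (1 <= K)%nat -> (L <= K)%nat ->
  (forall i, (i < L)%nat -> meets P (j0 + Z.of_nat i)) -> (L <= hits P)%nat.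
Proof.
  intros HK HL HM; unfold hits.
  assert (HKz : (0 < Z.of_nat K)%Z) by lia.
  rewrite <- (length_seq L 0), <- (length_map (fun i => (j0 + Z.of_nat i) mod Z.of_nat K)%Z).
  apply NoDup_incl_length.
  - apply NoDup_map_inj; [|apply seq_NoDup].
    intros i i' Hi Hi' E; apply in_seq in Hi; apply in_seq in Hi'.
    assert (Hq : ((Z.of_nat i - Z.of_nat i') mod Z.of_nat K = 0)%Z).
    { replace (Z.of_nat i - Z.of_nat i')%Z with ((j0 + Z.of_nat i) - (j0 + Z.of_nat i'))%Z by ring.
      rewrite Zminus_mod, E, Z.sub_diag; apply Zmod_0_l. }
    apply Z.mod_divide in Hq as [w Hw]; [|lia].
    assert (w = 0)%Z by nia; nia.
  - intros r Hr; apply in_map_iff in Hr as [i [<- Hi]]; apply in_seq in Hi.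
    pose proof (Z.mod_pos_bound (j0 + Z.of_nat i) (Z.of_nat K) HKz) as Hb.
    apply filter_In; split.
    + apply in_map_iff; exists (Z.to_nat ((j0 + Z.of_nat i) mod Z.of_nat K)); split; [lia|].
      apply in_seq; lia.
    + unfold hit; destruct excluded_middle_informative as [|Hn]; auto; exfalso; apply Hn.
      exists ((j0 + Z.of_nat i) / Z.of_nat K)%Z.
      rewrite Z.add_comm, <- Z_div_mod_eq_full; apply HM; lia.
Qed.

(** The levels met by a connected set are consecutive, and fewer than [K] consecutive ones are
    distinct modulo [K]. The component is thus enclosed between the two adjacent unmet levels,
    [hits P + 1] steps apart at most. *)
Lemma few_hits_strip P : (1 <= K)%nat -> (hits P < K)%nat ->
  exists c, forall z, path u P z -> c <= lin p q z <= c + (INR (hits P) + 1) / INR K.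
Proof.
  intros HK Hn.
  assert (HKr : 0 < INR K) by (apply lt_0_INR; lia).
  pose (j0 := (up (lin p q P * INR K) - 1)%Z).
  assert (Hj0 : IZR j0 / INR K <= lin p q P < (IZR j0 + 1) / INR K).
  { destruct (archimed (lin p q P * INR K)) as [A1 A2].
    unfold j0; rewrite minus_IZR; simpl; split.
    - apply Rmult_le_reg_r with (INR K); auto.
      unfold Rdiv; rewrite Rmult_assoc, Rinv_l by lra; lra.
    - apply Rmult_lt_reg_r with (INR K); auto.
      unfold Rdiv; rewrite Rmult_assoc, Rinv_l by lra; lra. }
  (* [P] lies between the levels [j0] and [j0 + 1]; the runs of met levels go up from [j0 + 1] and
     down from [j0], and are capped at [K] to stay within one period. *)
  destruct (longest_run (fun i => meets P (j0 + 1 + Z.of_nat i)) K) as [t [Ht1 [Ht2 Ht3]]].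
  destruct (longest_run (fun i => meets P (j0 - Z.of_nat i)) K) as [s [Hs1 [Hs2 Hs3]]].
  assert (Hrun : (Nat.min (s + t) K <= hits P)%nat).
  { apply (hits_run P (j0 + 1 - Z.of_nat s)); auto; [lia|].
    intros i Hi; destruct (Nat.lt_ge_cases i s) as [His|His].
    - replace (j0 + 1 - Z.of_nat s + Z.of_nat i)%Z with (j0 - Z.of_nat (s - 1 - i))%Z by lia.
      apply Hs2; lia.
    - replace (j0 + 1 - Z.of_nat s + Z.of_nat i)%Z with (j0 + 1 + Z.of_nat (i - s))%Z by lia.
      apply Ht2; lia. }
  (* A run of length [K] would give [K] hits, so both runs stop at an unmet level, which the
     component cannot cross. *)
  destruct Ht3 as [->|Ht3]; [lia|]; destruct Hs3 as [->|Hs3]; [lia|].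
  exists (IZR (j0 - Z.of_nat s) / INR K); intros z Hz; split.
  - apply Rnot_lt_le; intros Hlt; apply Hs3; apply path_level with (Q := z); auto.
    right; split; [lra|].
    apply Rle_trans with (2 := proj1 Hj0).
    apply Rmult_le_compat_r; [left; apply Rinv_0_lt_compat; auto|].
    apply IZR_le; lia.
  - apply Rle_trans with (IZR (j0 + 1 + Z.of_nat t) / INR K).
    + apply Rnot_lt_le; intros Hlt; apply Ht3; apply path_level with (Q := z); auto.
      left; split; [|lra].
      apply Rle_trans with (1 := Rlt_le _ _ (proj2 Hj0)).
      apply Rmult_le_compat_r; [left; apply Rinv_0_lt_compat; auto|].
      rewrite !plus_IZR; assert (0 <= IZR (Z.of_nat t)) by (apply IZR_le; lia); lra.
    + unfold Rdiv; rewrite <- Rmult_plus_distr_r.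
      apply Rmult_le_compat_r; [left; apply Rinv_0_lt_compat; auto|].
      assert (H : (s + t <= hits P)%nat) by lia.
      apply le_INR in H; rewrite plus_INR, !INR_IZR_INZ in H.
      rewrite minus_IZR, !plus_IZR, INR_IZR_INZ; lra.
Qed.

End Sampling.

(** Translation by [(a, b)] raises the level of [lin p q] by 1, so every hit of the class [r] can be
    moved to the single line of level [r / K]. This line passes through [(a, b) * r / K] and closes
    up along [(- q, p)], so [line_count] applies. *)
Lemma hits_per_line l p q a b D K (P : nat -> R * R) k r :
  (1 <= D)%nat -> (1 <= K)%nat -> (a * p + b * q = 1)%Z ->
  (forall c f m n, In (c, f, m, n) l -> (Z.abs (- q * m + p * n) <= Z.of_nat D)%Z) ->
  (forall i j, (i < k)%nat -> (j < k)%nat -> i <> j -> ~ nodal_rel (waves l) (P i) (P j)) ->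
  (length (filter (fun i => hit (waves l) p q K (P i) r) (seq 0 k)) <= 2 * D)%nat.
Proof.
  intros HD HK Hab Hl Hsep.
  pose (r2 := IZR p * IZR p + IZR q * IZR q).
  assert (HabR : IZR a * IZR p + IZR b * IZR q = 1)
    by (rewrite <- !mult_IZR, <- plus_IZR, Hab; auto).
  assert (Hr2 : 0 < r2).
  { unfold r2; destruct (Req_dec (IZR p) 0) as [E|E].
    - destruct (Req_dec (IZR q) 0) as [E'|E']; [rewrite E, E' in HabR; lra|nra].
    - nra. }
  assert (HKr : 0 < INR K) by (apply lt_0_INR; lia).
  set (u := waves l) in *.
  assert (Hu : periodic u) by apply waves_periodic.
  pose (x0 := IZR a * IZR r / INR K); pose (y0 := IZR b * IZR r / INR K).
  apply (line_count l D (- q) p x0 y0 P); auto.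
  - intros c f m n Hin; rewrite <- (Hl c f m n Hin); apply Z.eq_le_incl; f_equal; ring.
  - apply NoDup_filter, seq_NoDup.
  - intros i j Hi Hj; apply filter_In in Hi as [Hi _]; apply filter_In in Hj as [Hj _].
    apply in_seq in Hi; apply in_seq in Hj; apply Hsep; lia.
  - intros i Hi; apply filter_In in Hi as [_ Hi]; unfold hit in Hi.
    destruct excluded_middle_informative as [[w [z [Hz1 Hz2]]]|]; [|discriminate].
    pose (z' := shift z (- (a * w)) (- (b * w))).
    assert (Hz' : lin p q z' = IZR r / INR K).
    { rewrite plus_IZR, mult_IZR, <- INR_IZR_INZ in Hz2.
      replace (lin p q z') with (lin p q z - (IZR a * IZR p + IZR b * IZR q) * IZR w).
      - rewrite Hz2, HabR; field; lra.
      - unfold z', shift, lin; simpl; rewrite !opp_IZR, !mult_IZR; ring. }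
    (* The coordinate along [(- q, p)]; by [H0] the difference of [z'] and the base point has no
       component along [(p, q)]. *)
    pose (t := (- IZR q * (fst z' - x0) + IZR p * (snd z' - y0)) / r2).
    assert (H0 : IZR p * (fst z' - x0) + IZR q * (snd z' - y0) = 0).
    { unfold lin in Hz'.
      assert (E : IZR p * x0 + IZR q * y0 = (IZR a * IZR p + IZR b * IZR q) * (IZR r / INR K))
        by (unfold x0, y0; field; lra).
      rewrite HabR in E; lra. }
    assert (E1 : x0 + t * IZR (- q) = fst z').
    { rewrite opp_IZR; unfold t.
      apply Rplus_eq_reg_l with (- x0); ring_simplify.
      assert (E : r2 * (fst z' - x0) = IZR q * (IZR q * (fst z' - x0) - IZR p * (snd z' - y0))).
      { apply Rminus_diag_uniq.
        transitivity (IZR p * (IZR p * (fst z' - x0) + IZR q * (snd z' - y0)));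
          [unfold r2; ring|rewrite H0; ring]. }
      apply Rmult_eq_reg_l with r2; [|lra]; rewrite Rmult_plus_distr_l.
      replace (r2 * fst z') with (r2 * (fst z' - x0) + r2 * x0) by ring.
      rewrite E; field; lra. }
    assert (E2 : y0 + t * IZR p = snd z').
    { unfold t.
      assert (E : r2 * (snd z' - y0) = IZR p * (IZR p * (snd z' - y0) - IZR q * (fst z' - x0))).
      { apply Rminus_diag_uniq.
        transitivity (IZR q * (IZR p * (fst z' - x0) + IZR q * (snd z' - y0)));
          [unfold r2; ring|rewrite H0; ring]. }
      apply Rmult_eq_reg_l with r2; [|lra].
      replace (r2 * snd z') with (r2 * (snd z' - y0) + r2 * y0) by ring.
      rewrite E; field; lra. }
    exists t; rewrite E1, E2, <- surjective_pairing.
    pose proof (path_nonzero _ _ _ Hz1) as Hnz; split.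
    + unfold z', shift; simpl; rewrite periodic_shift; auto.
    + apply nodal_rel_trans with z; auto; [now apply path_nodal|now apply nodal_rel_shift].
Qed.

(** The sampled form of [a + b >= sqrt (2 / N)]: up to one step, the hit counts are [K] times the
    widths measured in levels, and these widths are [sqrt (p^2 + q^2)] times the Euclidean ones. *)
Lemma hits_product_bound l N p q K P :
  (forall c f m n, In (c, f, m, n) l -> (m * m + n * n = N)%Z) ->
  (1 <= K)%nat -> (0 < p * p + q * q)%Z -> (2 * (p * p + q * q) <= N)%Z ->
  waves l (fst P) (snd P) <> 0 ->
  2 * INR K ^ 2 * IZR (p * p + q * q) <=
  IZR N * (INR (hits (waves l) p q K P) + 1 + (INR (hits (waves l) (- q) p K P) + 1))^2.
Proof.
  intros HN HK Hr0 HrN HP.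
  set (u := waves l) in *; set (r2 := (p * p + q * q)%Z) in *.
  assert (HKr : 1 <= INR K) by (apply (le_INR 1); lia).
  assert (Hr : 0 < IZR r2) by (apply IZR_lt; auto).
  assert (HrN' : 2 * IZR r2 <= IZR N) by (rewrite <- mult_IZR; apply IZR_le; auto).
  set (X := INR (hits u p q K P) + 1); set (Y := INR (hits u (- q) p K P) + 1).
  assert (HX : 1 <= X) by (unfold X; pose proof (pos_INR (hits u p q K P)); lra).
  assert (HY : 1 <= Y) by (unfold Y; pose proof (pos_INR (hits u (- q) p K P)); lra).
  (* If one direction is saturated, there may be no enclosing rectangle; then [2 * r2 <= N] already
     gives the bound. *)
  assert (Hbig : INR K <= X + Y -> 2 * INR K ^ 2 * IZR r2 <= IZR N * (X + Y)^2).
  { intros H; apply Rle_trans with (IZR N * INR K ^ 2).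
    - assert (0 <= INR K ^ 2) by nra; nra.
    - apply Rmult_le_compat_l; nra. }
  destruct (Nat.lt_ge_cases (hits u p q K P) K) as [H1|H1];
    [|apply Hbig; apply le_INR in H1; unfold X in *; lra].
  destruct (Nat.lt_ge_cases (hits u (- q) p K P) K) as [H2|H2];
    [|apply Hbig; apply le_INR in H2; unfold Y in *; lra].
  destruct (few_hits_strip u p q K P HK H1) as [a Ha].
  destruct (few_hits_strip u (- q) p K P HK H2) as [b Hb].
  fold X in Ha; fold Y in Hb.
  assert (Er : IZR r2 = IZR p * IZR p + IZR q * IZR q)
    by (unfold r2; rewrite plus_IZR, !mult_IZR; auto).
  (* The coordinates [lin p q / r2], [lin (- q) p / r2] are orthogonal; they turn [u] into a sum of waves
     of squared frequency [r2 * N]. *)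
  pose (l' := map (fun '(c, f, m, n) => (c, f, (p * m + q * n)%Z, (- q * m + p * n)%Z)) l
    : list (R * R * Z * Z)).
  assert (El' : forall x y, waves l' x y =
    u (IZR p * x + IZR (- q) * y) (IZR q * x + IZR p * y)).
  { intros x y; unfold l', u; clear; induction l as [|[[[c f] m] n] l IH]; simpl; auto.
    rewrite IH; f_equal; f_equal; f_equal.
    rewrite !plus_IZR, !mult_IZR, opp_IZR; ring. }
  pose (x0 := lin p q P / IZR r2); pose (y0 := lin (- q) p P / IZR r2).
  assert (EP1 : IZR p * x0 + IZR (- q) * y0 = fst P).
  { unfold x0, y0, lin; rewrite opp_IZR, Er; field; lra. }
  assert (EP2 : IZR q * x0 + IZR p * y0 = snd P).
  { unfold x0, y0, lin; rewrite opp_IZR, Er; field; lra. }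
  assert (Hdiv : forall A c w, A * IZR r2 = c -> w <= c -> w / IZR r2 <= A).
  { intros A c w <- Hw; apply Rmult_le_reg_r with (IZR r2); auto.
    unfold Rdiv; rewrite Rmult_assoc, Rinv_l; lra. }
  assert (Hdiv' : forall A c w, A * IZR r2 = c -> c <= w -> A <= w / IZR r2).
  { intros A c w <- Hw; apply Rmult_le_reg_r with (IZR r2); auto.
    unfold Rdiv; rewrite Rmult_assoc, Rinv_l; lra. }
  assert (HXK : 0 < X / INR K) by (apply Rdiv_lt_0_compat; lra).
  assert (HYK : 0 < Y / INR K) by (apply Rdiv_lt_0_compat; lra).
  assert (Hbarta := barta l' (r2 * N) x0 y0 (a / IZR r2) ((a + X / INR K) / IZR r2)
    (b / IZR r2) ((b + Y / INR K) / IZR r2)).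
  assert (Hfreq : / ((a + X / INR K) / IZR r2 - a / IZR r2)^2 +
    / ((b + Y / INR K) / IZR r2 - b / IZR r2)^2 <= 4 * IZR (r2 * N)).
  { apply Hbarta.
    - intros c f m n Hin; apply in_map_iff in Hin as [[[[c' f'] m'] n'] [E Hin]].
      injection E as _ _ <- <-; rewrite <- (HN c' f' m' n' Hin); unfold r2; ring.
    - rewrite El', EP1, EP2; auto.
    - apply Rmult_lt_compat_r; [apply Rinv_0_lt_compat; auto|lra].
    - apply Rmult_lt_compat_r; [apply Rinv_0_lt_compat; auto|lra].
    - intros x y [g1 [g2 [G1 [G2 [G3 [G4 [G5 [G6 G7]]]]]]]]; simpl in G3, G4, G5, G6.
      assert (Hp : path u P (IZR p * x + IZR (- q) * y, IZR q * x + IZR p * y)).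
      { exists (fun t => IZR p * g1 t + IZR (- q) * g2 t), (fun t => IZR q * g1 t + IZR p * g2 t).
        assert (Hc : forall v w, continuity (fun t => v * g1 t + w * g2 t)).
        { intros v w; apply continuity_plus; apply continuity_mult; auto;
            apply continuity_const; intros ? ?; auto. }
        rewrite G3, G4, G5, G6; simpl; repeat split; auto.
        intros t; rewrite <- El'; auto. }
      pose proof (Ha _ Hp) as Hax; pose proof (Hb _ Hp) as Hbx.
      assert (E1 : lin p q (IZR p * x + IZR (- q) * y, IZR q * x + IZR p * y) = x * IZR r2)
        by (unfold lin; simpl; rewrite opp_IZR, Er; ring).
      assert (E2 : lin (- q) p (IZR p * x + IZR (- q) * y, IZR q * x + IZR p * y) = y * IZR r2)
        by (unfold lin; simpl; rewrite opp_IZR, Er; ring).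
      rewrite E1 in Hax; rewrite E2 in Hbx.
      repeat split; [eapply Hdiv|eapply Hdiv'|eapply Hdiv|eapply Hdiv']; eauto; lra. }
  rewrite mult_IZR in Hfreq.
  replace ((a + X / INR K) / IZR r2 - a / IZR r2) with (X / (INR K * IZR r2)) in Hfreq
    by (field; lra).
  replace ((b + Y / INR K) / IZR r2 - b / IZR r2) with (Y / (INR K * IZR r2)) in Hfreq
    by (field; lra).
  assert (H3 : INR K ^ 2 * IZR r2 * (X^2 + Y^2) <= 4 * IZR N * (X * Y)^2).
  { replace (INR K ^ 2 * IZR r2 * (X^2 + Y^2)) with
      ((/ (X / (INR K * IZR r2))^2 + / (Y / (INR K * IZR r2))^2) * ((X * Y)^2 / IZR r2))
      by (field; lra).
    replace (4 * IZR N * (X * Y)^2) with (4 * (IZR r2 * IZR N) * ((X * Y)^2 / IZR r2))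
      by (field; lra).
    apply Rmult_le_compat_r; auto.
    apply Rmult_le_pos; [nra|left; apply Rinv_0_lt_compat; auto]. }
  set (A := INR K ^ 2 * IZR r2) in *.
  assert (HA : 0 <= A) by (unfold A; nra).
  replace (2 * INR K ^ 2 * IZR r2) with (2 * A) by (unfold A; ring).
  assert (HXY : 1 <= X * Y) by nra.
  (* The product of [2 X Y <= X^2 + Y^2] and [4 X Y <= (X + Y)^2], which passes from inverse squares
     of the widths to their sum. *)
  assert (H4 : 8 * (X * Y)^2 <= (X^2 + Y^2) * (X + Y)^2).
  { pose proof (pow2_ge_0 (X - Y)).
    replace (8 * (X * Y)^2) with ((2 * (X * Y)) * (4 * (X * Y))) by ring.
    apply Rmult_le_compat; lra. }
  assert (H5 : A * (8 * (X * Y)^2) <= A * ((X^2 + Y^2) * (X + Y)^2))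
    by (apply Rmult_le_compat_l; auto).
  assert (H6 : A * (X^2 + Y^2) * (X + Y)^2 <= 4 * IZR N * (X * Y)^2 * (X + Y)^2)
    by (apply Rmult_le_compat_r; auto; nra).
  assert (H7 : 0 < (X * Y)^2) by nra.
  apply Rmult_le_reg_r with (4 * (X * Y)^2); [lra|].
  lra.
Qed.

Lemma list_sum_INR {A : Type} (f : A -> nat) c (I : list A) :
  (forall i, In i I -> c <= INR (f i)) -> INR (length I) * c <= INR (list_sum (map f I)).
Proof.
  induction I as [|i I IH]; intros H; [simpl; lra|].
  cbn [length map list_sum fold_right]; rewrite S_INR, plus_INR.
  specialize (IH (fun j Hj => H j (or_intror Hj))); specialize (H i (or_introl eq_refl)).
  unfold list_sum in IH; lra.
Qed.

Lemma list_sum_plus {A : Type} (f g : A -> nat) (I : list A) :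
  list_sum (map (fun i => f i + g i)%nat I) = (list_sum (map f I) + list_sum (map g I))%nat.
Proof. induction I; simpl; auto; unfold list_sum in *; lia. Qed.

Lemma nodal_bound l N p q a b D (P : nat -> R * R) k :
  (1 <= D)%nat -> (a * p + b * q = 1)%Z -> (0 < p * p + q * q)%Z -> (2 * (p * p + q * q) <= N)%Z ->
  (forall c f m n, In (c, f, m, n) l -> (m * m + n * n = N)%Z) ->
  (forall c f m n, In (c, f, m, n) l -> (Z.abs (p * m + q * n) <= Z.of_nat D)%Z) ->
  (forall c f m n, In (c, f, m, n) l -> (Z.abs (- q * m + p * n) <= Z.of_nat D)%Z) ->
  (forall i, (i < k)%nat -> waves l (fst (P i)) (snd (P i)) <> 0) ->
  (forall i j, (i < k)%nat -> (j < k)%nat -> i <> j -> ~ nodal_rel (waves l) (P i) (P j)) ->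
  (Z.of_nat k ^ 2 * (p * p + q * q) <= 8 * Z.of_nat D ^ 2 * N)%Z.
Proof.
  intros HD Hab Hr0 HrN HN HD1 HD2 Hnz Hsep.
  set (u := waves l) in *; set (r2 := (p * p + q * q)%Z) in *.
  assert (Hr : 0 < IZR r2) by (apply IZR_lt; auto).
  assert (HNr : 0 < IZR N) by (apply IZR_lt; lia).
  pose (kap := sqrt (2 * IZR r2 / IZR N)).
  assert (Hpos : 0 < 2 * IZR r2 / IZR N) by (apply Rdiv_lt_0_compat; lra).
  assert (Hkap : kap * kap = 2 * IZR r2 / IZR N) by (apply sqrt_sqrt; lra).
  assert (Hkap0 : 0 < kap) by (apply sqrt_lt_R0; auto).
  (* Each domain has at least [kap * K - 2] hits in the two directions together, and each of the
     [2 * K] lines meets at most [2 * D] domains. Dividing by [K] and letting it grow removes the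
     [2 * k]. *)
  assert (Hcount : forall K, (1 <= K)%nat ->
    INR k * (kap * INR K) <= 4 * INR D * INR K + 2 * INR k).
  { intros K HK.
    pose (f := fun i => (hits u p q K (P i) + hits u (- q) p K (P i) + 2)%nat).
    assert (Hlow : INR k * (kap * INR K) <= INR (list_sum (map f (seq 0 k)))).
    { rewrite <- (length_seq k 0) at 1; apply list_sum_INR; intros i Hi; apply in_seq in Hi.
      assert (H := hits_product_bound l N p q K (P i) HN HK Hr0 HrN (Hnz i ltac:(lia))).
      fold r2 u in H; unfold f; rewrite !plus_INR; simpl (INR 2).
      replace (INR (hits u p q K (P i)) + 1 + (INR (hits u (- q) p K (P i)) + 1)) with
        (INR (hits u p q K (P i)) + INR (hits u (- q) p K (P i)) + (1 + 1)) in H by ring.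
      set (T := INR (hits u p q K (P i)) + INR (hits u (- q) p K (P i)) + (1 + 1)) in *.
      assert (HT : 0 <= T).
      { unfold T; pose proof (pos_INR (hits u p q K (P i)));
        pose proof (pos_INR (hits u (- q) p K (P i))); lra. }
      apply Rsqr_incr_0_var; auto; unfold Rsqr.
      apply Rmult_le_reg_l with (IZR N); auto.
      replace (IZR N * (kap * INR K * (kap * INR K))) with (IZR N * (kap * kap) * INR K ^ 2) by ring.
      rewrite Hkap; replace (IZR N * (2 * IZR r2 / IZR N)) with (2 * IZR r2) by (field; lra).
      lra. }
    apply Rle_trans with (1 := Hlow).
    assert (Hup : (list_sum (map f (seq 0 k)) <= 4 * D * K + 2 * k)%nat).
    { unfold f; rewrite !list_sum_plus.
      assert (Hfam : forall v w a b, (a * v + b * w = 1)%Z ->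
        (forall c f m n, In (c, f, m, n) l -> (Z.abs (- w * m + v * n) <= Z.of_nat D)%Z) ->
        (list_sum (map (fun i => hits u v w K (P i)) (seq 0 k)) <= K * (2 * D))%nat).
      { intros v w a' b' Hab' Hw; unfold hits.
        rewrite (list_sum_exchange (fun i r => hit u v w K (P i) r)).
        apply Nat.le_trans with (1 := list_sum_le _ (2 * D) (residues K)
          (fun r _ => hits_per_line l v w a' b' D K P k r HD HK Hab' Hw Hsep)).
        unfold residues; rewrite length_map, length_seq; auto. }
      assert (H1 := Hfam p q a b Hab HD2).
      assert (H2 : (list_sum (map (fun i => hits u (- q) p K (P i)) (seq 0 k)) <= K * (2 * D))%nat).
      { apply (Hfam (- q)%Z p (- b)%Z a); [rewrite <- Hab; ring|].
        intros c f0 m n Hin; rewrite <- Z.abs_opp.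
        replace (- (- p * m + - q * n))%Z with (p * m + q * n)%Z by ring; eauto. }
      assert (H3 : (list_sum (map (fun _ => 2) (seq 0 k)) <= k * 2)%nat).
      { rewrite <- (length_seq k 0) at 2; apply list_sum_le; auto. }
      nia. }
    apply le_INR in Hup; rewrite plus_INR, !mult_INR in Hup; simpl INR in Hup; lra. }
  assert (Hmain : INR k * kap <= 4 * INR D).
  { apply Rnot_lt_le; intros Hlt.
    destruct (INR_unbounded (2 * INR k / (INR k * kap - 4 * INR D))) as [K HK].
    assert (HK0 : 0 <= 2 * INR k / (INR k * kap - 4 * INR D)).
    { apply Rmult_le_pos; [pose proof (pos_INR k); lra|left; apply Rinv_0_lt_compat; lra]. }
    assert (HK1 : (1 <= K)%nat) by (destruct K; [simpl in HK; lra|lia]).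
    specialize (Hcount K HK1).
    apply Rmult_lt_compat_r with (r := INR k * kap - 4 * INR D) in HK; [|lra].
    unfold Rdiv in HK; rewrite Rmult_assoc, Rinv_l in HK; lra. }
  apply le_IZR; rewrite !Z.pow_2_r, !mult_IZR, <- !INR_IZR_INZ.
  assert (HD0 := pos_INR D); assert (Hk0 := pos_INR k).
  assert (Hsq : (INR k * kap) * (INR k * kap) <= (4 * INR D) * (4 * INR D))
    by (apply Rmult_le_compat; auto; apply Rmult_le_pos; lra).
  replace ((INR k * kap) * (INR k * kap)) with (INR k ^ 2 * (kap * kap)) in Hsq by ring.
  rewrite Hkap in Hsq; apply Rmult_le_compat_r with (r := IZR N / 2) in Hsq; [|lra].
  replace (INR k ^ 2 * (2 * IZR r2 / IZR N) * (IZR N / 2)) with (INR k ^ 2 * IZR r2) in Hsq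
    by (field; lra).
  lra.
Qed.

(** * Hartley series *)

(* The Hartley functions [cos + sin] form a real orthonormal basis indexed by all of [Z]. *)
Definition cas (k : Z) (t : R) : R := cos (2 * PI * (IZR k * t)) + sin (2 * PI * (IZR k * t)).

Definition wave1 (k : Z) (f t : R) : R := cos (2 * PI * (IZR k * t) + f).

Lemma continuity_wave1 k f : continuity (wave1 k f).
Proof. intros t; unfold wave1; reg. Qed.

Lemma continuity_cas k : continuity (cas k).
Proof. intros t; unfold cas; reg. Qed.

Lemma ex_RInt_cont (f : R -> R) a b : continuity f -> ex_RInt f a b.
Proof.
  intros H; apply (ex_RInt_continuous (V := R_CompleteNormedModule)).
  intros z _; apply continuity_pt_filterlim, H.
Qed.

Lemma is_RInt_cont (f : R -> R) a b : continuity f -> is_RInt f a b (RInt f a b).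
Proof. intros H; exact (RInt_correct f a b (ex_RInt_cont f a b H)). Qed.

Lemma is_int_ext (f g : R -> R) a b (v : R) :
  (forall t, f t = g t) -> is_RInt f a b v -> is_RInt g a b v.
Proof. intros H; apply is_RInt_ext; intros t _; apply H. Qed.

Lemma is_int_lin (f g : R -> R) a b (v w c d : R) : is_RInt f a b v -> is_RInt g a b w ->
  is_RInt (fun t => c * f t + d * g t) a b (c * v + d * w).
Proof.
  intros H1 H2.
  exact (is_RInt_plus _ _ _ _ _ _ (is_RInt_scal _ _ _ c _ H1) (is_RInt_scal _ _ _ d _ H2)).
Qed.

Lemma cos_int k : cos (2 * PI * IZR k) = 1.
Proof. rewrite <- (Rplus_0_l (2 * PI * IZR k)), cos_period_Z; apply cos_0. Qed.

Lemma sin_int k : sin (2 * PI * IZR k) = 0.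
Proof.
  pose proof (sin2_cos2 (2 * PI * IZR k)) as H; rewrite cos_int in H.
  unfold Rsqr in H; nra.
Qed.

Lemma int_wave1 k f : k <> 0%Z -> is_RInt (wave1 k f) 0 1 0.
Proof.
  intros Hk; assert (Hk' : IZR k <> 0) by (apply not_0_IZR; auto).
  pose proof PI_RGT_0.
  pose (F := fun t => sin (2 * PI * (IZR k * t) + f) / (2 * PI * IZR k)).
  replace 0 with (minus (F 1) (F 0)) at 2.
  - apply (is_RInt_derive F (wave1 k f)); intros t _.
    + unfold F, wave1; auto_derive; auto; field; split; lra.
    + apply continuity_pt_filterlim, continuity_wave1.
  - unfold F, minus, plus, opp; simpl.
    rewrite Rmult_1_r, Rmult_0_r, Rmult_0_r, Rplus_0_l, sin_plus, cos_int, sin_int; field; split; lra.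
Qed.

Lemma is_RInt_const01 (c : R) : is_RInt (fun _ : R => c) 0 1 c.
Proof.
  pose proof (is_RInt_const 0 1 c) as H; unfold scal in H; simpl in H; unfold mult in H.
  simpl in H; rewrite Rminus_0_r, Rmult_1_l in H; exact H.
Qed.

(** The phase [- (PI / 2)] makes the second wave a sine, which has integral zero even at
    [m + n = 0]. Only the difference frequency can contribute, whence orthonormality without pairing
    [k] with [- k]. *)
Lemma cas_mult m n t :
  cas m t * cas n t = wave1 (m - n) 0 t + wave1 (m + n) (- (PI / 2)) t.
Proof.
  unfold cas, wave1; rewrite minus_IZR, plus_IZR.
  replace (2 * PI * ((IZR m - IZR n) * t) + 0) with
    (2 * PI * (IZR m * t) - 2 * PI * (IZR n * t)) by ring.
  replace (2 * PI * ((IZR m + IZR n) * t) + - (PI / 2)) with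
    (2 * PI * (IZR m * t) + 2 * PI * (IZR n * t) - PI / 2) by ring.
  rewrite (cos_minus _ (PI / 2)), cos_PI2, sin_PI2, cos_minus, sin_plus; ring.
Qed.

Lemma cas_orthonormal m n :
  is_RInt (fun t => cas m t * cas n t) 0 1 (if Z.eq_dec m n then 1 else 0).
Proof.
  apply is_int_ext with (fun t => 1 * wave1 (m - n) 0 t + 1 * wave1 (m + n) (- (PI / 2)) t);
    [intros; rewrite cas_mult; ring|].
  assert (H1 : is_RInt (wave1 (m - n) 0) 0 1 (if Z.eq_dec m n then 1 else 0)).
  { destruct Z.eq_dec as [->|Hne]; [|apply int_wave1; lia].
    apply is_int_ext with (fun _ => 1).
    - intros t; unfold wave1; rewrite Z.sub_diag, Rmult_0_l, Rmult_0_r, Rplus_0_l, cos_0; auto.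
    - apply is_RInt_const01. }
  assert (H2 : is_RInt (wave1 (m + n) (- (PI / 2))) 0 1 0).
  { destruct (Z.eq_dec (m + n) 0) as [->|Hne]; [|apply int_wave1; auto].
    apply is_int_ext with (fun _ => 0).
    - intros t; unfold wave1; rewrite Rmult_0_l, Rmult_0_r, Rplus_0_l, cos_neg, cos_PI2; auto.
    - apply is_RInt_const01. }
  pose proof (is_int_lin _ _ _ _ _ _ 1 1 H1 H2) as H.
  rewrite !Rmult_1_l, Rplus_0_r in H; exact H.
Qed.

Definition hcoef (f : R -> R) (k : Z) : R := RInt (fun t => f t * cas k t) 0 1.

Lemma wave1_cas k f t : wave1 k f t =
  (cos f - sin f) / 2 * cas k t + (cos f + sin f) / 2 * cas (- k) t.
Proof.
  unfold wave1, cas; rewrite opp_IZR, cos_plus.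
  replace (2 * PI * (- IZR k * t)) with (- (2 * PI * (IZR k * t))) by ring.
  rewrite cos_neg, sin_neg; field.
Qed.

Lemma hcoef_wave1 f : continuity f -> (forall k, hcoef f k = 0) ->
  forall k p, is_RInt (fun t => f t * wave1 k p t) 0 1 0.
Proof.
  intros Hc H k p.
  assert (Hk : forall j, is_RInt (fun t => f t * cas j t) 0 1 0).
  { intros j.
    assert (E : is_RInt (fun t => f t * cas j t) 0 1 (hcoef f j))
      by (apply is_RInt_cont, continuity_mult; auto using continuity_cas).
    rewrite H in E; exact E. }
  apply is_int_ext with (fun t => (cos p - sin p) / 2 * (f t * cas k t) +
    (cos p + sin p) / 2 * (f t * cas (- k) t)).
  { intros t; rewrite wave1_cas; ring. }
  pose proof (is_int_lin _ _ _ _ _ _ ((cos p - sin p) / 2) ((cos p + sin p) / 2)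
    (Hk k) (Hk (- k)%Z)) as H1.
  rewrite !Rmult_0_r, Rplus_0_r in H1; exact H1.
Qed.

(** One more kernel factor spreads a wave to the frequencies [k - 1], [k], [k + 1] with shifted
    phases; the extra factor [wave1 k p] in the statement is there for this induction. *)
Lemma kernel_orthogonal f x0 : continuity f -> (forall k, hcoef f k = 0) ->
  forall n k p, is_RInt (fun t => f t * ((1 + wave1 1 (- (2 * PI * x0)) t) / 2) ^ n * wave1 k p t) 0 1 0.
Proof.
  intros Hc H n; induction n as [|n IH]; intros k p.
  - apply is_int_ext with (fun t => f t * wave1 k p t); [intros; simpl; ring|].
    apply hcoef_wave1; auto.
  - set (a := 2 * PI * x0) in *.
    set (T := fun t => (1 + wave1 1 (- a) t) / 2) in *.
    apply is_int_ext with (fun t => /2 * (f t * T t ^ n * wave1 k p t) + 1 *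
      (/4 * (f t * T t ^ n * wave1 (k + 1) (p - a) t) + /4 * (f t * T t ^ n * wave1 (k - 1) (p + a) t))).
    { intros t; fold (T t); simpl pow.
      assert (E : T t * wave1 k p t =
        /2 * wave1 k p t + (/4 * wave1 (k + 1) (p - a) t + /4 * wave1 (k - 1) (p + a) t)).
      { unfold T, wave1; rewrite plus_IZR, minus_IZR.
        replace (2 * PI * ((IZR k + 1) * t) + (p - a)) with
          ((2 * PI * (IZR k * t) + p) + (2 * PI * (1 * t) + - a)) by ring.
        replace (2 * PI * ((IZR k - 1) * t) + (p + a)) with
          ((2 * PI * (IZR k * t) + p) - (2 * PI * (1 * t) + - a)) by ring.
        rewrite (cos_plus (2 * PI * (IZR k * t) + p)), (cos_minus (2 * PI * (IZR k * t) + p)); field. }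
      replace (f t * (T t * T t ^ n) * wave1 k p t) with (f t * T t ^ n * (T t * wave1 k p t)) by ring.
      rewrite E; ring. }
    pose proof (is_int_lin _ _ _ _ _ _ (/2) 1 (IH k p)
      (is_int_lin _ _ _ _ _ _ (/4) (/4) (IH (k + 1)%Z (p - a)) (IH (k - 1)%Z (p + a)))) as H1.
    rewrite !Rmult_0_r, Rplus_0_r, Rmult_0_r, Rplus_0_r in H1; exact H1.
Qed.

Lemma RInt_ge_const (f : R -> R) a b c : continuity f -> a <= b ->
  (forall t, a <= t <= b -> c <= f t) -> (b - a) * c <= RInt f a b.
Proof.
  intros Hf Hab H.
  replace ((b - a) * c) with (RInt (fun _ => c) a b)
    by (rewrite RInt_const; unfold scal; simpl; unfold mult; simpl; ring).
  apply RInt_le; auto using ex_RInt_cont.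
  - apply ex_RInt_const.
  - intros; apply H; lra.
Qed.

(* The kernel [cos^(2n) (pi (t - x0))] concentrates at [x0] as [n] grows. *)
Lemma hcoef_zero_nonpos f x0 : continuity f -> (forall k, hcoef f k = 0) ->
  0 < x0 < 1 -> f x0 <= 0.
Proof.
  intros Hc H Hx0; apply Rnot_lt_le; intros Hpos.
  destruct (continuity_eps_inv f Hc x0 (f x0 / 2) ltac:(lra)) as [d0 [Hd0 Hnear]].
  (* The interval of radius [d] about [x0] lies in [(0, 1)], [f] exceeds [f x0 / 2] on it, and
     [d < 1/2] keeps the cosines monotone where they are compared. *)
  pose (d := Rmin d0 (Rmin (Rmin x0 (1 - x0)) (1/2)) / 2).
  assert (Hd : 0 < d /\ d < d0 /\ d < x0 /\ d < 1 - x0 /\ d < 1/2).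
  { assert (0 < Rmin d0 (Rmin (Rmin x0 (1 - x0)) (1/2))) by (repeat apply Rmin_pos; lra).
    unfold d in *; pose proof (Rmin_l d0 (Rmin (Rmin x0 (1 - x0)) (1/2))).
    pose proof (Rmin_r d0 (Rmin (Rmin x0 (1 - x0)) (1/2))).
    pose proof (Rmin_l (Rmin x0 (1 - x0)) (1/2)); pose proof (Rmin_r (Rmin x0 (1 - x0)) (1/2)).
    pose proof (Rmin_l x0 (1 - x0)); pose proof (Rmin_r x0 (1 - x0)); lra. }
  destruct Hd as [Hd [Hdd0 [Hdx [Hd1x Hd2]]]].
  pose proof PI_RGT_0 as HPI.
  pose (T := fun t => (1 + wave1 1 (- (2 * PI * x0)) t) / 2).
  assert (ET : forall t, T t = (1 + cos (2 * PI * (t - x0))) / 2).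
  { intros t; unfold T, wave1; do 3 f_equal; ring. }
  (* The values of the kernel base at distance [d / 2] and [d] from [x0]: it is at least [al] inside
     the first and at most [be] outside the second. *)
  set (al := (1 + cos (PI * d)) / 2); set (be := (1 + cos (2 * PI * d)) / 2).
  assert (Hbe0 : 0 <= be) by (unfold be; pose proof (COS_bound (2 * PI * d)); lra).
  assert (Hab : be < al).
  { assert (cos (2 * PI * d) < cos (PI * d)) by (apply cos_decreasing_1; nra).
    unfold al, be; lra. }
  assert (HTlow : forall t, Rabs (t - x0) <= d / 2 -> al <= T t).
  { intros t Ht; rewrite ET; unfold al.
    assert (cos (PI * d) <= cos (2 * PI * (t - x0))); [|lra].
    destruct (Rle_dec 0 (t - x0)) as [Hs|Hs].
    - rewrite Rabs_right in Ht by lra; apply cos_decr_1; nra.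
    - rewrite Rabs_left in Ht by lra; rewrite <- (cos_neg (2 * PI * (t - x0))).
      apply cos_decr_1; nra. }
  assert (HThigh : forall t, 0 <= t <= 1 -> d <= Rabs (t - x0) -> T t <= be).
  { assert (Hh : forall s, d <= s <= 1 - d -> cos (2 * PI * s) <= cos (2 * PI * d)).
    { intros s Hs; destruct (Rle_dec s (1/2)) as [Hs2|Hs2].
      - apply cos_decr_1; nra.
      - rewrite <- (cos_neg (2 * PI * s)), <- (cos_period (- (2 * PI * s)) 1); simpl INR.
        apply cos_decr_1; nra. }
    intros t Ht Hs; rewrite ET; unfold be.
    assert (cos (2 * PI * (t - x0)) <= cos (2 * PI * d)); [|lra].
    destruct (Rle_dec 0 (t - x0)) as [Hs0|Hs0].
    - rewrite Rabs_right in Hs by lra; apply Hh; lra.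
    - rewrite Rabs_left in Hs by lra; rewrite <- (cos_neg (2 * PI * (t - x0))).
      replace (- (2 * PI * (t - x0))) with (2 * PI * (x0 - t)) by ring; apply Hh; lra. }
  assert (HT0 : forall t, 0 <= T t).
  { intros t; rewrite ET; pose proof (COS_bound (2 * PI * (t - x0))); lra. }
  destruct (continuity_ab_min f 0 1 ltac:(lra) (fun c _ => Hc c)) as [xm [Hmin _]].
  pose (M := Rmax 1 (- f xm)).
  assert (HM : 1 <= M) by apply Rmax_l.
  assert (HfM : forall t, 0 <= t <= 1 -> - M <= f t).
  { intros t Ht; specialize (Hmin t Ht); pose proof (Rmax_r 1 (- f xm)); unfold M; lra. }
  (* The integral of [f * T ^ n] is zero. The inner interval, of length [d], contributes at least
     the left side; elsewhere the integrand is at least [- M * be ^ n], being nonnegative where [T]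
     may exceed [be]. Since [be < al], this fails for large [n]. *)
  assert (Hn : forall n, d * (f x0 / 2) * al ^ n <= M * be ^ n).
  { intros n.
    pose (g := fun t => f t * T t ^ n).
    assert (HcT : continuity T).
    { intros t; unfold T, wave1; reg. }
    assert (Hg : continuity g).
    { apply continuity_mult; auto; clear - HcT; induction n as [|n IH]; simpl.
      - apply continuity_const; intros ? ?; auto.
      - apply (continuity_mult T (fun t => T t ^ n)); auto. }
    assert (I0 : RInt g 0 1 = 0).
    { apply is_RInt_unique, is_int_ext with (2 := kernel_orthogonal f x0 Hc H n 0 0).
      intros t; unfold g, T, wave1; rewrite Rmult_0_l, Rmult_0_r, Rplus_0_l, cos_0; ring. }
    rewrite <- (RInt_Chasles g 0 (x0 - d / 2) 1),
      <- (RInt_Chasles g (x0 - d / 2) (x0 + d / 2) 1) in I0 by (apply ex_RInt_cont; auto).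
    unfold plus in I0; simpl in I0.
    assert (Hbn : 0 <= be ^ n) by (apply pow_le; auto).
    assert (Hfd : forall t, Rabs (t - x0) <= d -> f x0 / 2 <= f t).
    { intros t Ht; specialize (Hnear t ltac:(lra)); apply Rabs_def2 in Hnear; lra. }
    assert (Hside : forall t, 0 <= t <= 1 -> - (M * be ^ n) <= g t).
    { intros t Ht; unfold g; destruct (Rle_dec d (Rabs (t - x0))) as [Hs|Hs].
      - assert (Hp : 0 <= T t ^ n <= be ^ n)
          by (split; [apply pow_le; auto|apply pow_incr; auto]).
        specialize (HfM t Ht).
        apply Rle_trans with (- (M * T t ^ n)); [apply Ropp_le_contravar; nra|nra].
      - specialize (Hfd t ltac:(lra)); pose proof (pow_le (T t) n (HT0 t)).
        assert (0 <= M * be ^ n) by nra; nra. }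
    assert (H1 := RInt_ge_const g 0 (x0 - d / 2) _ Hg ltac:(lra)
      (fun t Ht => Hside t ltac:(lra))).
    assert (H3 := RInt_ge_const g (x0 + d / 2) 1 _ Hg ltac:(lra)
      (fun t Ht => Hside t ltac:(lra))).
    assert (H2 : (x0 + d / 2 - (x0 - d / 2)) * (f x0 / 2 * al ^ n) <=
      RInt g (x0 - d / 2) (x0 + d / 2)).
    { apply RInt_ge_const; auto; [lra|]; intros t Ht; unfold g.
      assert (Habs : Rabs (t - x0) <= d / 2) by (apply Rabs_le; lra).
      apply Rmult_le_compat; [lra|apply pow_le; lra|apply Hfd; lra|].
      apply pow_incr; split; [lra|apply HTlow; auto]. }
    assert (0 <= M * be ^ n) by nra.
    nra. }
  pose (rho := be / al).
  assert (Hal : 0 < al) by lra.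
  assert (Hrho : 0 <= rho < 1).
  { unfold rho; split; [apply Rmult_le_pos; [auto|left; apply Rinv_0_lt_compat; auto]|].
    apply Rmult_lt_reg_r with al; auto; unfold Rdiv; rewrite Rmult_assoc, Rinv_l; lra. }
  assert (Hc0 : 0 < d * (f x0 / 2) / M) by (apply Rdiv_lt_0_compat; nra).
  destruct (pow_lt_1_zero rho ltac:(rewrite Rabs_right; lra) _ Hc0) as [n Hpn].
  specialize (Hpn n (Nat.le_refl n)); specialize (Hn n).
  rewrite Rabs_right in Hpn by (apply Rle_ge, pow_le; lra).
  assert (Han : 0 < al ^ n) by (apply pow_lt; auto).
  assert (Ebe : be ^ n = rho ^ n * al ^ n)
    by (rewrite <- Rpow_mult_distr; unfold rho; f_equal; field; lra).
  assert (Hlt : M * rho ^ n < d * (f x0 / 2)).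
  { apply Rmult_lt_compat_l with (r := M) in Hpn; [|lra].
    replace (M * (d * (f x0 / 2) / M)) with (d * (f x0 / 2)) in Hpn by (field; lra); auto. }
  rewrite Ebe in Hn; nra.
Qed.

(** The sign bound, applied to [f] and [- f], settles the open period; continuity gives the
    endpoint. *)
Lemma hcoef_unique f : continuity f -> (forall t, f (t + 1) = f t) ->
  (forall k, hcoef f k = 0) -> forall t, f t = 0.
Proof.
  intros Hc Hper H.
  assert (Hopen : forall t, 0 < t < 1 -> f t = 0).
  { intros t Ht; apply Rle_antisym; [apply hcoef_zero_nonpos; auto|].
    assert (Hneg : - f t <= 0); [|lra].
    apply (hcoef_zero_nonpos (fun t => - f t)); auto; [apply continuity_opp; auto|].
    intros k; specialize (H k); unfold hcoef in *.
    apply is_RInt_unique, is_int_ext with (fun t => opp (f t * cas k t)).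
    - intros s; unfold opp; simpl; ring.
    - assert (E : is_RInt (fun t => f t * cas k t) 0 1 (RInt (fun t => f t * cas k t) 0 1))
        by (apply is_RInt_cont, continuity_mult; auto using continuity_cas).
      rewrite H in E; apply is_RInt_opp in E; unfold opp at 2 in E; simpl in E.
      rewrite Ropp_0 in E; exact E. }
  assert (H0 : f 0 = 0).
  { apply NNPP; intros Hne.
    destruct (continuity_eps_inv f Hc 0 (Rabs (f 0)) (Rabs_pos_lt _ Hne)) as [d [Hd Hnear]].
    pose (t := Rmin d 1 / 2).
    assert (Ht : 0 < t < 1 /\ t < d).
    { assert (0 < Rmin d 1) by (apply Rmin_pos; lra); unfold t.
      pose proof (Rmin_l d 1); pose proof (Rmin_r d 1); lra. }
    specialize (Hnear t ltac:(rewrite Rminus_0_r, Rabs_right; lra)).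
    rewrite Hopen, Rminus_0_l, Rabs_Ropp in Hnear by lra; lra. }
  assert (HpZ : forall t k, f (t + IZR k) = f t).
  { intros t k; refine (periodic_shift (fun x _ => f x) _ t 0 k 0%Z).
    intros x y; split; auto. }
  intros t; destruct (archimed t) as [A1 A2].
  rewrite <- (HpZ t (- (up t - 1))%Z), opp_IZR, minus_IZR.
  set (s := t + - (IZR (up t) - 1)).
  assert (Hs : 0 <= s < 1) by (unfold s; lra).
  destruct (Req_dec s 0) as [->|Hs0]; auto; apply Hopen; lra.
Qed.

(** * Expansion of eigenfunctions *)

Definition rsum (f : Z -> R) (l : list Z) : R := fold_right (fun k s => f k + s) 0 l.

Lemma rsum_ext f g l : (forall k, In k l -> f k = g k) -> rsum f l = rsum g l.
Proof.
  induction l as [|a l IH]; simpl; intros H; auto.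
  rewrite (H a), IH; simpl; auto.
Qed.

Lemma rsum_scal c f l : rsum (fun k => c * f k) l = c * rsum f l.
Proof. induction l as [|a l IH]; simpl; [ring|rewrite IH; ring]. Qed.

Lemma rsum_zero f l : (forall k, In k l -> f k = 0) -> rsum f l = 0.
Proof.
  induction l as [|a l IH]; simpl; intros H; auto.
  rewrite (H a), IH; simpl; auto; ring.
Qed.

Lemma rsum_delta (a : Z -> R) j l : NoDup l -> (~ In j l -> a j = 0) ->
  rsum (fun k => a k * (if Z.eq_dec k j then 1 else 0)) l = a j.
Proof.
  intros Hd; induction Hd as [|b l Hb Hd IH]; intros Hj; simpl; [rewrite Hj; auto|].
  destruct (Z.eq_dec b j) as [->|Hne].
  - rewrite rsum_zero; [ring|].
    intros k Hk; destruct Z.eq_dec as [->|]; [contradiction|ring].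
  - rewrite IH; [ring|]; intros Hn; apply Hj; intros [E|E]; auto.
Qed.

Lemma is_int_rsum (F : Z -> R -> R) (I : Z -> R) l :
  (forall k, In k l -> is_RInt (F k) 0 1 (I k)) ->
  is_RInt (fun t => rsum (fun k => F k t) l) 0 1 (rsum I l).
Proof.
  induction l as [|a l IH]; simpl; intros H; [apply is_RInt_const01|].
  apply (is_RInt_plus (V := R_NormedModule)); auto.
Qed.

Lemma continuity_rsum (F : Z -> R -> R) l :
  (forall k, continuity (F k)) -> continuity (fun t => rsum (fun k => F k t) l).
Proof.
  intros H; induction l as [|a l IH]; simpl.
  - apply continuity_const; intros ? ?; auto.
  - apply (continuity_plus (F a)); auto.
Qed.

Lemma cas_periodic k t : cas k (t + 1) = cas k t.
Proof.
  unfold cas; replace (2 * PI * (IZR k * (t + 1))) with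
    (2 * PI * (IZR k * t) + 2 * PI * IZR k) by ring.
  rewrite cos_period_Z, sin_plus, cos_int, sin_int; ring.
Qed.

Lemma hcoef_is_int f k : continuity f -> is_RInt (fun t => f t * cas k t) 0 1 (hcoef f k).
Proof. intros H; apply is_RInt_cont, continuity_mult; auto using continuity_cas. Qed.

(** With finitely many coefficients no convergence question arises: [f] minus the finite sum has all
    coefficients zero. *)
Lemma hartley_expansion f l : continuity f -> (forall t, f (t + 1) = f t) -> NoDup l ->
  (forall k, ~ In k l -> hcoef f k = 0) ->
  forall t, f t = rsum (fun k => hcoef f k * cas k t) l.
Proof.
  intros Hc Hp Hd H0.
  pose (s := fun t => rsum (fun k => hcoef f k * cas k t) l).
  assert (Hs : continuity s).
  { apply continuity_rsum; intros k; apply continuity_mult; auto using continuity_cas.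
    apply continuity_const; intros ? ?; auto. }
  assert (H : forall t, f t - s t = 0); [|intros t; specialize (H t); unfold s in H; lra].
  apply hcoef_unique.
  - apply continuity_minus; auto.
  - intros t; rewrite Hp; f_equal; apply rsum_ext; intros; now rewrite cas_periodic.
  - intros j; apply is_RInt_unique.
    assert (Hsj : is_RInt (fun t => s t * cas j t) 0 1 (hcoef f j)).
    { rewrite <- (rsum_delta (hcoef f) j l) by auto.
      apply is_int_ext with (fun t => rsum (fun k => hcoef f k * (cas k t * cas j t)) l).
      - intros t; unfold s; rewrite (Rmult_comm (rsum _ _)), <- rsum_scal.
        apply rsum_ext; intros; ring.
      - apply is_int_rsum; intros k _.
        apply (is_RInt_scal (V := R_NormedModule)), cas_orthonormal. }
    pose proof (is_int_lin _ _ _ _ _ _ 1 (-1) (hcoef_is_int f j Hc) Hsj) as H.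
    replace (1 * hcoef f j + -1 * hcoef f j) with 0 in H by ring.
    refine (is_int_ext _ _ _ _ _ _ H); intros; ring.
Qed.

Lemma derivative_periodic g g1 : (forall t, derivable_pt_lim g t (g1 t)) ->
  (forall t, g (t + 1) = g t) -> forall t, g1 (t + 1) = g1 t.
Proof.
  intros H Hp t; apply (uniqueness_limite g t); auto.
  intros eps Heps; destruct (H (t + 1) eps Heps) as [d Hd]; exists d; intros h Hh Hhd.
  specialize (Hd h Hh Hhd); rewrite Hp in Hd.
  replace (t + 1 + h) with (t + h + 1) in Hd by ring; rewrite Hp in Hd; exact Hd.
Qed.

Lemma hcoef_second_derivative g g1 g2 k :
  (forall t, derivable_pt_lim g t (g1 t)) -> (forall t, derivable_pt_lim g1 t (g2 t)) ->
  continuity g2 -> (forall t, g (t + 1) = g t) ->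
  hcoef g2 k = - (2 * PI * IZR k)^2 * hcoef g k.
Proof.
  intros H1 H2 Hc Hp; set (w := 2 * PI * IZR k).
  assert (Hgc : continuity g) by (intros t; apply derivable_continuous_pt; exists (g1 t); apply H1).
  pose (cas' := fun t => w * (cos (2 * PI * (IZR k * t)) - sin (2 * PI * (IZR k * t)))).
  assert (D1 : forall t, derivable_pt_lim (cas k) t (cas' t)).
  { intros t; unfold cas, cas', w; apply is_derive_Reals; auto_derive; auto; ring. }
  assert (D2 : forall t, derivable_pt_lim cas' t (- w^2 * cas k t)).
  { intros t; unfold cas, cas', w; apply is_derive_Reals; auto_derive; auto; ring. }
  (* Two integrations by parts at once: [F' = g2 * cas - g * cas''], and periodicity cancels the
     boundary values. *)
  pose (F := fun t => g1 t * cas k t - g t * cas' t).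
  assert (DF : is_RInt (fun t => g2 t * cas k t + w^2 * (g t * cas k t)) 0 1 (minus (F 1) (F 0))).
  { apply (is_RInt_derive F); intros t _.
    - apply is_derive_Reals.
      replace (g2 t * cas k t + w^2 * (g t * cas k t)) with
        (g2 t * cas k t + g1 t * cas' t - (g1 t * cas' t + g t * (- w^2 * cas k t))) by ring.
      apply (derivable_pt_lim_minus (fun t => g1 t * cas k t) (fun t => g t * cas' t)).
      + apply (derivable_pt_lim_mult g1 (cas k)); auto.
      + apply (derivable_pt_lim_mult g cas'); auto.
    - apply continuity_pt_filterlim.
      apply (continuity_pt_plus (fun t => g2 t * cas k t) (fun t => w^2 * (g t * cas k t))).
      + apply (continuity_pt_mult g2 (cas k)); auto; apply continuity_cas.
      + apply (continuity_pt_scal (fun t => g t * cas k t)).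
        apply (continuity_pt_mult g (cas k)); auto; apply continuity_cas. }
  assert (E : F 1 = F 0).
  { assert (H1' := derivative_periodic g g1 H1 Hp 0); rewrite Rplus_0_l in H1'.
    assert (Hp' := Hp 0); rewrite Rplus_0_l in Hp'.
    assert (C1 := cas_periodic k 0); rewrite Rplus_0_l in C1.
    assert (C2 := derivative_periodic (cas k) cas' D1 (cas_periodic k) 0); rewrite Rplus_0_l in C2.
    unfold F; rewrite H1', Hp', C1, C2; auto. }
  rewrite E in DF; unfold minus, plus, opp in DF; simpl in DF; rewrite Rplus_opp_r in DF.
  pose proof (is_int_lin _ _ _ _ _ _ 1 (- w^2) DF (hcoef_is_int g k Hgc)) as H.
  unfold hcoef at 1; apply is_RInt_unique.
  replace (- w^2 * hcoef g k) with (1 * 0 + - w^2 * hcoef g k) by ring.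
  refine (is_int_ext _ _ _ _ _ _ H); intros; simpl; ring.
Qed.

Lemma cont2_continuity_2d f x y : cont2 f -> continuity_2d_pt f x y.
Proof.
  intros H eps; destruct (H x y eps (cond_pos eps)) as [d [Hd Hd']].
  exists (mkposreal d Hd); auto.
Qed.

Lemma cont2_slice f x : cont2 f -> continuity (f x).
Proof.
  intros H; apply continuity_eps; intros y eps Heps.
  destruct (H x y eps Heps) as [d [Hd Hd']]; exists d; split; auto.
  intros s Hs; apply Hd'; auto; rewrite Rminus_diag, Rabs_R0; auto.
Qed.

Lemma hcoef_param v vx n :
  (forall x y, derivable_pt_lim (fun t => v t y) x (vx x y)) -> cont2 v -> cont2 vx ->
  forall x, derivable_pt_lim (fun x => hcoef (v x) n) x (hcoef (vx x) n).
Proof.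
  intros Hv Hc Hcx x; apply is_derive_Reals.
  assert (HD : forall z t, is_derive (fun u => v u t * cas n t) z (vx z t * cas n t)).
  { intros z t; apply is_derive_Reals.
    replace (vx z t * cas n t) with (vx z t * cas n t + v z t * 0) by ring.
    apply (derivable_pt_lim_mult (fun u => v u t) (fun _ => cas n t)); auto.
    apply derivable_pt_lim_const. }
  replace (hcoef (vx x) n) with (RInt (fun t => Derive (fun u => v u t * cas n t) x) 0 1).
  - apply (is_derive_RInt_param (fun x t => v x t * cas n t) 0 1 x).
    + exists (mkposreal 1 Rlt_0_1); intros z _ t _; eexists; apply HD.
    + intros t _; apply continuity_2d_pt_ext with (fun z s => vx z s * cas n s).
      * intros z s; symmetry; apply is_derive_unique, HD.
      * apply continuity_2d_pt_mult; [apply cont2_continuity_2d; auto|].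
        apply (continuity_1d_2d_pt_comp (cas n) (fun _ s => s));
          [apply continuity_cas|apply continuity_2d_pt_id2].
    + exists (mkposreal 1 Rlt_0_1); intros z _; apply ex_RInt_cont.
      apply continuity_mult; [apply cont2_slice; auto|apply continuity_cas].
  - apply RInt_ext; intros t _; apply is_derive_unique, HD.
Qed.

(** The coefficients in [y] satisfy [G'' = (4 PI^2 n^2 - mu) G]; taking coefficients in [x] leaves
    [(mu - 4 PI^2 (m^2 + n^2)) h m n = 0]. The sum runs over a square instead of the circle, so that
    eigenfunctions of different eigenvalues share one index set in [eig_family_bound]. *)
Lemma eigenfunction_expansion mu u : is_eigenfunction mu u -> exists h : Z -> Z -> R,
  (forall m n, h m n <> 0 -> mu = 4 * PI^2 * IZR (m * m + n * n)) /\
  forall B, (0 <= B)%Z -> mu < 4 * PI^2 * (IZR B + 1)^2 -> forall x y,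
    u x y = rsum (fun n => rsum (fun m => h m n * (cas m x * cas n y)) (zrange B)) (zrange B).
Proof.
  intros [Hp [_ [ux [uy [uxx [uxy [uyx [uyy [Dx [Dy [Dxx [_ [_ [Dyy
    [Cu [Cx [Cy [Cxx [_ [_ [Cyy Heq]]]]]]]]]]]]]]]]]]]]].
  pose (G := fun n x => hcoef (u x) n).
  assert (G1 : forall n x, derivable_pt_lim (G n) x (hcoef (ux x) n))
    by (intros n; apply hcoef_param; auto).
  assert (Guxx : forall n x, hcoef (uxx x) n = (4 * PI^2 * (IZR n * IZR n) - mu) * G n x).
  { intros n x.
    assert (Hyy : hcoef (uyy x) n = - (2 * PI * IZR n)^2 * G n x).
    { apply hcoef_second_derivative with (uy x); auto; [apply cont2_slice; auto|].
      intros t; apply Hp. }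
    unfold hcoef at 1; apply is_RInt_unique.
    replace ((4 * PI ^ 2 * (IZR n * IZR n) - mu) * G n x) with
      (- mu * G n x + -1 * hcoef (uyy x) n) by (rewrite Hyy; ring).
    refine (is_int_ext _ _ _ _ _ _ (is_int_lin _ _ _ _ _ _ (- mu) (-1)
      (hcoef_is_int (u x) n (cont2_slice _ _ Cu)) (hcoef_is_int (uyy x) n (cont2_slice _ _ Cyy)))).
    intros t; simpl; replace (uxx x t) with (- mu * u x t - uyy x t) by (specialize (Heq x t); lra).
    ring. }
  assert (G2 : forall n x, derivable_pt_lim (fun x => hcoef (ux x) n) x
     ((4 * PI^2 * (IZR n * IZR n) - mu) * G n x)).
  { intros n x; rewrite <- Guxx; apply hcoef_param; auto. }
  assert (Gc : forall n, continuity (G n)).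
  { intros n x; apply derivable_continuous_pt; exists (hcoef (ux x) n); apply G1. }
  assert (Gp : forall n x, G n (x + 1) = G n x).
  { intros n x; unfold G, hcoef; apply RInt_ext; intros t _; rewrite (proj1 (Hp x t)); auto. }
  pose (h := fun m n => hcoef (G n) m).
  assert (Hh : forall m n, h m n <> 0 -> mu = 4 * PI^2 * IZR (m * m + n * n)).
  { intros m n Hne; unfold h in Hne.
    assert (E := hcoef_second_derivative (G n) _ _ m (G1 n) (G2 n)
      ltac:(apply (continuity_scal (G n)); auto) (Gp n)).
    assert (E' : hcoef (fun t => (4 * PI^2 * (IZR n * IZR n) - mu) * G n t) m =
      (4 * PI^2 * (IZR n * IZR n) - mu) * hcoef (G n) m).
    { unfold hcoef at 1; apply is_RInt_unique.
      pose proof (is_int_lin _ _ _ _ _ _ (4 * PI^2 * (IZR n * IZR n) - mu) 0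
        (hcoef_is_int (G n) m (Gc n)) (hcoef_is_int (G n) m (Gc n))) as H.
      rewrite Rmult_0_l, Rplus_0_r in H; refine (is_int_ext _ _ _ _ _ _ H); intros; simpl; ring. }
    rewrite E' in E; rewrite plus_IZR, !mult_IZR.
    apply Rmult_eq_reg_r with (hcoef (G n) m); auto; lra. }
  exists h; split; auto; intros B HB Hmu x y.
  assert (Hbig : forall m n, (~ In m (zrange B) \/ ~ In n (zrange B)) -> h m n = 0).
  { intros m n Hmn; apply NNPP; intros Hne; apply Hh in Hne.
    assert (HB1 : ((B + 1) * (B + 1) <= m * m + n * n)%Z).
    { rewrite !in_zrange in Hmn by auto; destruct Hmn as [Hm|Hm]; nia. }
    apply IZR_le in HB1; rewrite mult_IZR, plus_IZR in HB1.
    pose proof PI_RGT_0; assert (0 < PI^2) by nra; rewrite Hne in Hmu; nra. }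
  rewrite (hartley_expansion (u x) (zrange B)).
  - apply rsum_ext; intros n _; change (hcoef (u x) n) with (G n x).
    rewrite (hartley_expansion (G n) (zrange B) (Gc n) (Gp n) (NoDup_zrange B)
      (fun m Hm => Hbig m n (or_introl Hm))).
    rewrite Rmult_comm, <- rsum_scal; apply rsum_ext; intros m _; unfold h; ring.
  - apply cont2_slice; auto.
  - intros t; apply Hp.
  - apply NoDup_zrange.
  - intros n Hn; change (G n x = 0); apply (hcoef_unique (G n)); auto.
    intros m; apply (Hbig m n); auto.
Qed.

(** * Eigenvalue counts *)

Definition phi (m n : Z) (x y : R) : R := cas m x * cas n y.

Lemma cas_0 k : cas k 0 = 1.
Proof. unfold cas; rewrite !Rmult_0_r, cos_0, sin_0; ring. Qed.

Lemma cont2_prod f g : continuity f -> continuity g -> cont2 (fun x y => f x * g y).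
Proof.
  intros Hf Hg x y eps Heps.
  assert (H : continuity_2d_pt (fun x y => f x * g y) x y).
  { apply continuity_2d_pt_mult.
    - apply (continuity_1d_2d_pt_comp f (fun x _ => x)); [apply Hf|apply continuity_2d_pt_id1].
    - apply (continuity_1d_2d_pt_comp g (fun _ y => y)); [apply Hg|apply continuity_2d_pt_id2]. }
  destruct (H (mkposreal eps Heps)) as [d Hd]; exists d; split; [apply cond_pos|auto].
Qed.

Lemma phi_eigenfunction m n : is_eigenfunction (4 * PI^2 * IZR (m * m + n * n)) (phi m n).
Proof.
  pose (D := fun k t => 2 * PI * IZR k * (cos (2 * PI * (IZR k * t)) - sin (2 * PI * (IZR k * t)))).
  assert (D1 : forall k t, derivable_pt_lim (cas k) t (D k t)).
  { intros k t; unfold cas, D; apply is_derive_Reals; auto_derive; auto; ring. }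
  assert (D2 : forall k t, derivable_pt_lim (D k) t (- (2 * PI * IZR k)^2 * cas k t)).
  { intros k t; unfold cas, D; apply is_derive_Reals; auto_derive; auto; ring. }
  assert (DL : forall f f' c t, derivable_pt_lim f t (f' t) ->
    derivable_pt_lim (fun t => f t * c) t (f' t * c)).
  { intros f f' c t H; replace (f' t * c) with (f' t * c + f t * 0) by ring.
    apply (derivable_pt_lim_mult f (fun _ => c)); auto; apply derivable_pt_lim_const. }
  assert (DR : forall f f' c t, derivable_pt_lim f t (f' t) ->
    derivable_pt_lim (fun t => c * f t) t (c * f' t)).
  { intros f f' c t H; apply (derivable_pt_lim_scal f); auto. }
  assert (C0 := continuity_cas).
  assert (C1 : forall k, continuity (D k)) by (intros k t; unfold D; reg).
  assert (C2 : forall k, continuity (fun t => - (2 * PI * IZR k)^2 * cas k t)).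
  { intros k; apply (continuity_scal (cas k)); auto. }
  split; [|split].
  - intros x y; unfold phi; now rewrite !cas_periodic.
  - exists 0, 0; unfold phi; rewrite !cas_0; lra.
  - exists (fun x y => D m x * cas n y), (fun x y => cas m x * D n y),
      (fun x y => - (2 * PI * IZR m)^2 * cas m x * cas n y), (fun x y => D m x * D n y),
      (fun x y => D m x * D n y), (fun x y => cas m x * (- (2 * PI * IZR n)^2 * cas n y)).
    repeat split; try (apply cont2_prod; auto); intros x y; unfold phi.
    + apply DL; auto.
    + apply DR; auto.
    + apply (DL (D m) (fun x => - (2 * PI * IZR m)^2 * cas m x)); auto.
    + apply DR; auto.
    + apply DL; auto.
    + apply (DR (D n) (fun y => - (2 * PI * IZR n)^2 * cas n y)); auto.
    + rewrite plus_IZR, !mult_IZR; ring.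
Qed.

(** * Eigenfunctions as waves with frequencies on one circle *)

Definition on_circle (N : Z) (l : list (R * R * Z * Z)) : Prop :=
  forall c f m n, In (c, f, m, n) l -> (m * m + n * n = N)%Z.

Lemma rsum_waves N (F : Z -> R -> R -> R) l :
  (forall k, exists w, on_circle N w /\ forall x y, F k x y = waves w x y) ->
  exists w, on_circle N w /\ forall x y, rsum (fun k => F k x y) l = waves w x y.
Proof.
  intros H; induction l as [|k l [w [Hw1 Hw2]]].
  - exists []; split; auto; intros ? ? ? ? [].
  - destruct (H k) as [w' [Hw1' Hw2']]; exists (w' ++ w); split.
    + intros c f m n Hin; apply in_app_iff in Hin as [Hin|Hin]; eauto.
    + intros x y; simpl; rewrite Hw2, Hw2'; clear.
      induction w' as [|[[[c f] m] n] w' IH]; simpl; [ring|rewrite <- IH; ring].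
Qed.

Lemma eigenfunction_waves mu u : is_eigenfunction mu u ->
  exists a b w, mu = 4 * PI^2 * IZR (a * a + b * b) /\ on_circle (a * a + b * b) w /\ u = waves w.
Proof.
  intros Hu; destruct (eigenfunction_expansion mu u Hu) as [h [Hh Hexp]].
  pose proof PI_RGT_0 as HPI.
  assert (HB : exists B, (0 <= B)%Z /\ mu < 4 * PI^2 * (IZR B + 1)^2).
  { destruct (archimed (Rabs mu)) as [A1 _]; exists (up (Rabs mu)).
    pose proof (Rabs_pos mu); split; [apply le_IZR; lra|].
    apply Rle_lt_trans with (1 := Rle_abs mu).
    pose proof PI2_1; set (B := IZR (up (Rabs mu))) in *.
    assert (1 < PI^2) by nra; assert (B < (B + 1)^2) by nra; nra. }
  destruct HB as [B [HB1 HB2]]; specialize (Hexp B HB1 HB2).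
  destruct (classic (exists a b, h a b <> 0)) as [[a [b Hab]]|Hz].
  - exists a, b; apply Hh in Hab as Emu.
    destruct (rsum_waves (a * a + b * b)
      (fun n x y => rsum (fun m => h m n * (cas m x * cas n y)) (zrange B)) (zrange B))
      as [w [Hw1 Hw2]].
    { intros n; apply rsum_waves; intros m.
      destruct (Req_dec (h m n) 0) as [E|E].
      - exists []; split; [intros ? ? ? ? []|]; intros; rewrite E; simpl; ring.
      (* [cas m x * cas n y] is the cosine of the frequency [(m, - n)] plus the sine of [(m, n)],
         both on the same circle. *)
      - exists [(h m n, 0, m, (- n)%Z); (h m n, - (PI / 2), m, n)]; split.
        + assert (Emn : (m * m + n * n = a * a + b * b)%Z).
          { apply Hh in E; apply eq_IZR; rewrite Emu in E.
            apply Rmult_eq_reg_l with (4 * PI^2); [auto|nra]. }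
          intros c f m' n' [[= _ _ <- <-]|[[= _ _ <- <-]|[]]]; lia.
        + intros x y; simpl; unfold cas; rewrite opp_IZR.
          replace (2 * PI * (IZR m * x + - IZR n * y) + 0) with
            (2 * PI * (IZR m * x) - 2 * PI * (IZR n * y)) by ring.
          replace (2 * PI * (IZR m * x + IZR n * y) + - (PI / 2)) with
            (2 * PI * (IZR m * x) + 2 * PI * (IZR n * y) - PI / 2) by ring.
          rewrite (cos_minus _ (PI / 2)), cos_PI2, sin_PI2, cos_minus, sin_plus; ring. }
    exists w; repeat split; auto.
    apply functional_extensionality; intros x; apply functional_extensionality; intros y.
    rewrite Hexp; auto.
  - exfalso; destruct Hu as [_ [[x [y Hxy]] _]]; apply Hxy; rewrite Hexp.
    apply rsum_zero; intros n _; apply rsum_zero; intros m _.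
    destruct (Req_dec (h m n) 0) as [->|E]; [ring|exfalso; eauto].
Qed.

(** * Orthogonality and linear independence of the products [phi] *)

Definition int2 (F : R -> R -> R) (v : R) : Prop :=
  exists G : R -> R, (forall x, is_RInt (F x) 0 1 (G x)) /\ is_RInt G 0 1 v.

Lemma int2_unique F v w : int2 F v -> int2 F w -> v = w.
Proof.
  intros [G [HG1 HG2]] [H [HH1 HH2]].
  assert (E : G = H).
  { apply functional_extensionality; intros x.
    rewrite <- (is_RInt_unique _ _ _ _ (HG1 x)); apply is_RInt_unique, HH1. }
  subst H; rewrite <- (is_RInt_unique _ _ _ _ HG2); apply is_RInt_unique, HH2.
Qed.

Definition phis (l : list (Z * Z)) : list (R -> R -> R) := map (fun p => phi (fst p) (snd p)) l.

Lemma pair_eq_dec (p q : Z * Z) : {p = q} + {p <> q}.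
Proof. decide equality; apply Z.eq_dec. Qed.

Fixpoint coef_at (p : Z * Z) (cs : list R) (l : list (Z * Z)) : R :=
  match cs, l with
  | c :: cs', q :: l' => c * (if pair_eq_dec q p then 1 else 0) + coef_at p cs' l'
  | _, _ => 0
  end.

(** The inner product with [phi] at [p] reads off the coefficient at [p], summed over repetitions in
    [l]; [NoDup] later leaves a single one. *)
Lemma int2_lincomb p cs l :
  int2 (fun x y => lincomb cs (phis l) x y * phi (fst p) (snd p) x y) (coef_at p cs l).
Proof.
  revert l; induction cs as [|c cs IH]; intros l.
  - exists (fun _ => 0); split; [intros x|apply is_RInt_const01].
    refine (is_int_ext _ _ _ _ _ _ (is_RInt_const01 0)); intros; simpl; ring.
  - destruct l as [|[m n] l].
    + exists (fun _ => 0); split; [intros x|apply is_RInt_const01].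
      refine (is_int_ext _ _ _ _ _ _ (is_RInt_const01 0)); intros; simpl; ring.
    + destruct (IH l) as [G [HG1 HG2]]; destruct p as [m0 n0]; cbn [fst snd coef_at] in *.
      set (d := if Z.eq_dec n n0 then 1 else 0).
      set (d' := if Z.eq_dec m m0 then 1 else 0).
      exists (fun x => c * d * (cas m x * cas m0 x) + 1 * G x); split.
      * intros x.
        assert (H := is_int_lin _ _ _ _ _ _ (c * (cas m x * cas m0 x)) 1
          (cas_orthonormal n n0) (HG1 x)).
        fold d in H.
        replace (c * d * (cas m x * cas m0 x)) with (c * (cas m x * cas m0 x) * d) by ring.
        refine (is_int_ext _ _ _ _ _ _ H); intros y; simpl; unfold phi; simpl; ring.
      * assert (H := is_int_lin _ _ _ _ _ _ (c * d) 1 (cas_orthonormal m m0) HG2).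
        replace (c * (if pair_eq_dec (m, n) (m0, n0) then 1 else 0) + coef_at (m0, n0) cs l) with
          (c * d * (if Z.eq_dec m m0 then 1 else 0) + 1 * coef_at (m0, n0) cs l); auto.
        unfold d; destruct pair_eq_dec as [E|E]; [injection E as -> ->|];
          repeat destruct Z.eq_dec; subst; try contradiction; try (exfalso; auto; fail); ring.
Qed.

Lemma coef_at_spec c p cs l : NoDup l -> In (c, p) (combine cs l) -> coef_at p cs l = c.
Proof.
  intros Hd; revert cs; induction Hd as [|q l Hq Hd IH]; intros cs Hin.
  - destruct cs; destruct Hin.
  - destruct cs as [|a cs]; simpl in *; [contradiction|].
    assert (Hzero : forall cs, ~ In p l -> coef_at p cs l = 0).
    { clear; induction l as [|q l IH]; intros [|a cs] Hn; simpl; auto.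
      destruct pair_eq_dec as [->|]; [exfalso; apply Hn; simpl; auto|].
      rewrite IH; [ring|]; intros H; apply Hn; simpl; auto. }
    destruct Hin as [[= -> ->]|Hin].
    + destruct pair_eq_dec; [|contradiction]; rewrite Hzero; auto; ring.
    + destruct pair_eq_dec as [->|]; [exfalso; apply Hq; eapply in_combine_r; eauto|].
      rewrite IH; auto; ring.
Qed.

Lemma phis_lin_indep l : NoDup l -> lin_indep (phis l).
Proof.
  intros Hd cs Hlen H0 c Hc.
  unfold phis in Hlen; rewrite length_map in Hlen.
  assert (Hp : exists p, In (c, p) (combine cs l)).
  { clear - Hlen Hc; revert l Hlen; induction cs as [|a cs IH]; intros [|q l] Hlen; simpl in *;
      try contradiction; try discriminate.
    destruct Hc as [->|Hc]; [exists q; auto|].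
    destruct (IH Hc l) as [p Hp]; [congruence|eauto]. }
  destruct Hp as [p Hp].
  rewrite <- (coef_at_spec c p cs l Hd Hp).
  apply int2_unique with (1 := int2_lincomb p cs l).
  exists (fun _ => 0); split; [intros x|apply is_RInt_const01].
  refine (is_int_ext _ _ _ _ _ _ (is_RInt_const01 0)); intros y; simpl.
  fold (phis l) in H0; rewrite H0; ring.
Qed.

Lemma phis_family (P : R -> Prop) l : NoDup l ->
  (forall m n, In (m, n) l -> P (4 * PI^2 * IZR (m * m + n * n))) -> eig_family P (phis l).
Proof.
  intros Hd HP; split; [now apply phis_lin_indep|].
  intros f Hf; apply in_map_iff in Hf as [[m n] [<- Hin]].
  eexists; split; [apply HP, Hin|apply phi_eigenfunction].
Qed.

(** * Linear dependence and finite multiplicities *)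

Fixpoint comb {J : Type} (cs : list R) (rows : list (J -> R)) (j : J) : R :=
  match cs, rows with
  | c :: cs', r :: rows' => c * r j + comb cs' rows' j
  | _, _ => 0
  end.

Lemma comb_app {J : Type} c1 c2 (r1 r2 : list (J -> R)) j : length c1 = length r1 ->
  comb (c1 ++ c2) (r1 ++ r2) j = comb c1 r1 j + comb c2 r2 j.
Proof.
  revert r1; induction c1 as [|c c1 IH]; intros [|r r1] H; simpl in *; try discriminate; [ring|].
  rewrite IH by congruence; ring.
Qed.

(** The combination of the multipliers [a r'] is again a [comb], of rows over the one-point index
    [unit]. *)
Lemma comb_eliminate {J : Type} (a : (J -> R) -> R) (r : J -> R) cs rows j :
  comb cs (map (fun r' j => r' j - a r' * r j) rows) j =
  comb cs rows j - comb cs (map (fun r' (_ : unit) => a r') rows) tt * r j.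
Proof.
  revert rows; induction cs as [|c cs IH]; intros [|r' rows]; simpl; try ring.
  rewrite IH; ring.
Qed.

(** Gaussian elimination, one column at a time: a pivot row [r] clears the column [j0], and a
    dependence among the remaining rows lifts by giving [r] the coefficient [- s]. *)
Lemma linear_dependence {J : Type} (js : list J) : forall rows : list (J -> R),
  (length js < length rows)%nat ->
  exists cs, length cs = length rows /\ (exists c, In c cs /\ c <> 0) /\
    forall j, In j js -> comb cs rows j = 0.
Proof.
  induction js as [|j0 js IH]; intros rows Hlen.
  - destruct rows as [|r rows]; simpl in Hlen; [lia|].
    exists (1 :: repeat 0 (length rows)); simpl; rewrite repeat_length; repeat split; auto.
    + exists 1; split; auto; lra.
    + intros j [].
  - destruct (classic (exists r, In r rows /\ r j0 <> 0)) as [[r [Hr Hr0]]|Hn].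
    + apply in_split in Hr as [r1 [r2 ->]].
      pose (a := fun r' : J -> R => r' j0 / r j0).
      destruct (IH (map (fun r' j => r' j - a r' * r j) (r1 ++ r2))) as [cs [Hcs [[c [Hc1 Hc2]] Hcs0]]].
      { rewrite length_map, length_app in *; simpl in Hlen; lia. }
      rewrite length_map, length_app in Hcs.
      pose (c1 := firstn (length r1) cs); pose (c2 := skipn (length r1) cs).
      assert (E : cs = c1 ++ c2) by (symmetry; apply firstn_skipn).
      assert (Hc1l : length c1 = length r1) by (unfold c1; rewrite length_firstn; lia).
      pose (s := comb cs (map (fun r' (_ : unit) => a r') (r1 ++ r2)) tt).
      exists (c1 ++ (- s) :: c2).
      assert (Hcomb : forall j, comb (c1 ++ - s :: c2) (r1 ++ r :: r2) j =
        comb cs (r1 ++ r2) j - s * r j).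
      { intros j; rewrite E, !comb_app by auto; simpl; ring. }
      repeat split.
      * rewrite !length_app; simpl; rewrite E, length_app in Hcs; lia.
      * exists c; split; auto; rewrite E in Hc1; apply in_app_iff in Hc1.
        apply in_app_iff; simpl; tauto.
      * intros j [<-|Hj]; rewrite Hcomb.
        -- assert (Es : s * r j0 = comb cs (r1 ++ r2) j0); [|lra].
           unfold s, a; clear - Hr0; generalize (r1 ++ r2) as rows; intros rows.
           revert rows; induction cs as [|c cs IH]; intros [|r' rows]; simpl; try ring.
           rewrite Rmult_plus_distr_r, IH; field; auto.
        -- specialize (Hcs0 j Hj); rewrite comb_eliminate in Hcs0; exact Hcs0.
    + destruct (IH rows) as [cs [H1 [H2 H3]]]; [simpl in Hlen; lia|].
      exists cs; repeat split; auto; intros j [<-|Hj]; auto.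
      assert (Hz : forall r, In r rows -> r j0 = 0).
      { intros r Hr; apply NNPP; intros Hne; apply Hn; eauto. }
      clear - Hz; revert cs; induction rows as [|r rows IH]; intros [|c cs]; simpl; auto.
      rewrite (Hz r), IH; simpl; auto; [ring|].
      intros r' Hr'; apply Hz; simpl; auto.
Qed.

(** The square has [(2 * B + 1)^2] indices. For [B = 0] this is the exact count 1; for larger [B] it
    yields finiteness. *)
Lemma eig_family_bound (P : R -> Prop) B fs : (0 <= B)%Z ->
  (forall mu, P mu -> mu < 4 * PI^2 * (IZR B + 1)^2) ->
  eig_family P fs -> (length fs <= length (list_prod (zrange B) (zrange B)))%nat.
Proof.
  intros HB HP [Hind Heig]; apply Nat.nlt_ge; intros Hlt.
  pose (expand := fun (h : Z * Z -> R) x y =>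
    rsum (fun n => rsum (fun m => h (m, n) * (cas m x * cas n y)) (zrange B)) (zrange B)).
  assert (Hrows : exists rows : list (Z * Z -> R), length rows = length fs /\
    forall cs x y, lincomb cs fs x y = expand (comb cs rows) x y).
  { clear - HB HP Heig; induction fs as [|f fs IH].
    - exists []; split; auto; intros cs x y.
      unfold expand; rewrite rsum_zero; [destruct cs; auto|].
      intros n _; apply rsum_zero; intros m _; destruct cs; simpl; ring.
    - destruct IH as [rows [H1 H2]]; [intros g Hg; apply Heig; simpl; auto|].
      destruct (Heig f (or_introl eq_refl)) as [mu [Hmu Hf]].
      destruct (eigenfunction_expansion mu f Hf) as [h [_ Hh]].
      specialize (Hh B HB (HP mu Hmu)).
      exists ((fun p => h (fst p) (snd p)) :: rows); split; [simpl; auto|].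
      intros [|c cs] x y; cbn [lincomb comb].
      + unfold expand; rewrite rsum_zero; auto.
        intros n _; apply rsum_zero; intros m _; ring.
      + rewrite H2, Hh; unfold expand; cbn [fst snd]; clear.
        generalize (zrange B) at 2 4 6 as l; intros l; induction l as [|n l IHl]; simpl; [ring|].
        rewrite <- IHl.
        assert (E : forall l', rsum (fun m => (c * h m n + comb cs rows (m, n)) * (cas m x * cas n y)) l'
          = c * rsum (fun m => h m n * (cas m x * cas n y)) l' +
            rsum (fun m => comb cs rows (m, n) * (cas m x * cas n y)) l').
        { intros l'; induction l' as [|m l' IHl']; simpl; [ring|rewrite IHl'; ring]. }
        rewrite E; ring. }
  destruct Hrows as [rows [H1 H2]].
  destruct (linear_dependence (list_prod (zrange B) (zrange B)) rows) as [cs [C1 [[c [C2 C3]] C4]]];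
    [rewrite H1; auto|].
  apply C3, (Hind cs); [congruence| |auto].
  intros x y; rewrite H2; apply rsum_zero; intros n Hn; apply rsum_zero; intros m Hm.
  rewrite C4; [ring|apply in_prod; auto].
Qed.

(** * Courant-sharp eigenvalues *)

Lemma PI2_pos : 0 < 4 * PI^2.
Proof. pose proof PI_RGT_0; nra. Qed.

Lemma nu_lower_bound N k : (1 <= N)%Z -> nu (4 * PI^2 * IZR N) k ->
  (length (pts N) + 1 <= k)%nat.
Proof.
  intros HN [_ [[a [b [[_ Ha] [_ [Hak _]]]]] _]].
  assert (H := Ha (phis (pts N))); unfold phis in H at 2; rewrite length_map in H.
  assert (length (pts N) <= a)%nat; [|lia].
  apply H, phis_family; [apply NoDup_pts|].
  intros m n Hmn; apply in_pts in Hmn; auto.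
  apply Rmult_lt_compat_l; [apply PI2_pos|now apply IZR_lt].
Qed.

Lemma not_courant_sharp N : (2 <= N)%Z -> ~ courant_sharp (4 * PI^2 * IZR N).
Proof.
  intros HN [u [k [Hu [Hnu [ps [Hlen [Hnz [Hsep _]]]]]]]].
  apply nu_lower_bound in Hnu; [|lia].
  destruct (eigenfunction_waves _ _ Hu) as [a [b [w [E [Hw ->]]]]].
  apply Rmult_eq_reg_l in E; [|pose proof PI2_pos; lra].
  apply eq_IZR in E; rewrite <- E in Hw.
  pose (P := fun i => nth i ps (0, 0)).
  assert (HP : forall i, (i < k)%nat -> waves w (fst (P i)) (snd (P i)) <> 0).
  { intros i Hi; apply Hnz, nth_In; lia. }
  assert (main : forall p q a b D, (1 <= D)%nat -> (a * p + b * q = 1)%Z ->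
    (0 < p * p + q * q)%Z -> (2 * (p * p + q * q) <= N)%Z ->
    (forall m n, m * m + n * n = N -> Z.abs (p * m + q * n) <= Z.of_nat D)%Z ->
    (forall m n, m * m + n * n = N -> Z.abs (- q * m + p * n) <= Z.of_nat D)%Z ->
    (Z.of_nat k ^ 2 * (p * p + q * q) <= 8 * Z.of_nat D ^ 2 * N)%Z).
  { intros p q a' b' D H1 H2 H3 H4 H5 H6.
    apply (nodal_bound w N p q a' b' D P k); auto; intros c f m n Hin;
      apply Hw in Hin; auto. }
  assert (Hsqrt : forall x B, (0 <= B -> x * x < (B + 1) * (B + 1) -> Z.abs x <= B)%Z).
  { intros x B HB Hx; apply Z.lt_succ_r, Z.square_lt_simpl_nonneg; [lia|].
    rewrite Z.abs_square; exact Hx. }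
  destruct (Z.eq_dec N 4) as [->|H4].
  (* [(m + n)^2 + (m - n)^2 = 8] gives [D = 2]; then [k >= 10] contradicts [2 * k^2 <= 128]. *)
  { assert (H := main 1%Z 1%Z 1%Z 0%Z 2%nat ltac:(lia) eq_refl eq_refl ltac:(lia)
      ltac:(intros m n Hmn; apply Hsqrt; [lia|pose proof (Z.square_nonneg (m - n)); lia])
      ltac:(intros m n Hmn; apply Hsqrt; [lia|pose proof (Z.square_nonneg (m + n)); lia])).
    assert (L : length (pts 4) = 9%nat) by reflexivity; nia. }
  destruct (Z.eq_dec N 25) as [->|H25].
  (* [(3 m + n)^2 + (m - 3 n)^2 = 250 < 16^2] gives [D = 15]; then [k >= 70] contradicts
     [10 * k^2 <= 45000]. *)
  { assert (H := main 3%Z 1%Z 0%Z 1%Z 15%nat ltac:(lia) eq_refl eq_refl ltac:(lia)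
      ltac:(intros m n Hmn; apply Hsqrt; [lia|pose proof (Z.square_nonneg (m - 3 * n)); lia])
      ltac:(intros m n Hmn; apply Hsqrt; [lia|pose proof (Z.square_nonneg (3 * m + n)); lia])).
    assert (L : length (pts 25) = 69%nat) by reflexivity; nia. }
  destruct (Z.sqrt_spec N ltac:(lia)) as [Hs1 Hs2].
  pose proof (Z.sqrt_nonneg N) as Hs0.
  assert (Hpts := length_pts_bound N HN H4 H25).
  set (s := Z.sqrt N) in *; clearbody s.
  assert (H := main 1%Z 0%Z 1%Z 0%Z (Z.to_nat s)); rewrite Z2Nat.id in H by auto.
  unfold Z.succ in Hs2.
  specialize (H ltac:(nia) eq_refl eq_refl ltac:(lia)
    ltac:(intros; apply Hsqrt; nia) ltac:(intros; apply Hsqrt; nia)).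
  nia.
Qed.

Lemma few_eigenvalues_below N k : (2 <= N)%Z -> lambda_k k (4 * PI^2 * IZR N) -> (5 < k)%nat.
Proof.
  intros HN [a [b [[_ Ha] [_ [Hak _]]]]].
  assert (H := Ha (phis [(0, 0); (1, 0); (-1, 0); (0, 1); (0, -1)]%Z)).
  assert (5 <= a)%nat; [|lia].
  apply H, phis_family.
  - repeat constructor; simpl; intuition discriminate.
  - intros m n Hmn; apply Rmult_lt_compat_l; [apply PI2_pos|apply IZR_lt].
    destruct Hmn as [E|[E|[E|[E|[E|[]]]]]]; injection E as <- <-; lia.
Qed.

(** A bounded set of lengths has a maximum. This provides the count needed in [nu_1] without
    computing the dimension. *)
Lemma eig_count_exists P fs0 M : eig_family P fs0 ->
  (forall fs, eig_family P fs -> (length fs <= M)%nat) ->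
  exists b, (length fs0 <= b)%nat /\ eig_count P b.
Proof.
  intros H0 HM; remember (M - length fs0)%nat as d eqn:Hd.
  revert fs0 H0 Hd; induction d as [d IH] using lt_wf_ind; intros fs0 H0 Hd.
  destruct (classic (exists fs, eig_family P fs /\ (length fs0 < length fs)%nat)) as [[fs [H1 H2]]|Hn].
  - specialize (HM fs H1) as HM1.
    destruct (IH (M - length fs)%nat ltac:(lia) fs H1 eq_refl) as [b [Hb1 Hb2]].
    exists b; split; auto; lia.
  - exists (length fs0); split; auto; split; [eauto|].
    intros fs Hfs; apply Nat.nlt_ge; intros Hlt; apply Hn; eauto.
Qed.

(** * The two Courant-sharp eigenvalues *)

Lemma phi_0 x y : phi 0 0 x y = 1.
Proof. unfold phi, cas; rewrite !Rmult_0_l, Rmult_0_r, cos_0, sin_0; ring. Qed.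

Lemma count_lt_first : eig_count (fun mu => mu < 4 * PI^2) 1.
Proof.
  pose proof PI2_pos; split.
  - exists (phis [(0, 0)%Z]); split; auto; apply phis_family.
    + repeat constructor; simpl; auto.
    + intros m n [[= <- <-]|[]]; simpl; lra.
  - intros fs Hfs; apply (eig_family_bound _ 0 fs (Z.le_refl 0)) in Hfs; auto.
    intros mu Hmu; simpl; lra.
Qed.

Lemma nu_0 : nu 0 1.
Proof.
  pose proof PI2_pos as HPI; split; [auto|split; [|auto]].
  exists 0%nat, 1%nat; split; [|split; [|split; auto]].
  - split.
    + exists []; split; auto; split; [|intros f []].
      intros [|c cs] Hl _ c' Hc'; [destruct Hc'|discriminate].
    + intros [|f fs] [_ Hf]; auto; exfalso.
      destruct (Hf f (or_introl eq_refl)) as [mu [Hmu Heig]].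
      destruct (eigenfunction_waves _ _ Heig) as [a [b [w [E _]]]].
      assert (0 <= IZR (a * a + b * b)) by (apply IZR_le; nia).
      rewrite E in Hmu; nra.
  - split.
    + exists (phis [(0, 0)%Z]); split; auto; apply phis_family.
      * repeat constructor; simpl; auto.
      * intros m n [[= <- <-]|[]]; simpl; lra.
    + intros fs Hfs; apply (eig_family_bound _ 0 fs (Z.le_refl 0)) in Hfs; auto.
      intros mu Hmu; simpl; lra.
Qed.

Lemma nu_1 : nu (4 * PI^2) 2.
Proof.
  pose proof PI2_pos as HPI; split; [auto|split].
  - assert (Hb : exists b, (length (phis [(0, 0); (1, 0)]%Z) <= b)%nat /\
      eig_count (fun mu => mu <= 4 * PI^2) b).
    { apply eig_count_exists with 9%nat.
      - apply phis_family.
        + repeat constructor; simpl; intuition discriminate.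
        + intros m n [[= <- <-]|[[= <- <-]|[]]]; simpl; lra.
      - intros fs Hfs; apply (eig_family_bound _ 1 fs Z.le_0_1) in Hfs; auto.
        intros mu Hmu; simpl; lra. }
    destruct Hb as [b [Hb1 Hb2]]; exists 1%nat, b.
    split; [apply count_lt_first|split; [exact Hb2|split; [auto|exact Hb1]]].
  - intros j _ [a [b [[_ Ha] [_ [Haj _]]]]].
    destruct count_lt_first as [[fs [Hfs1 Hfs2]] _].
    specialize (Ha fs Hfs1); lia.
Qed.

Lemma courant_sharp_0 : courant_sharp 0.
Proof.
  exists (phi 0 0), 1%nat; split; [|split; [exact nu_0|]].
  - replace 0 with (4 * PI^2 * IZR (0 * 0 + 0 * 0)) by (simpl; ring); apply phi_eigenfunction.
  - exists [(0, 0)]; split; [auto|split; [|split]].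
    + intros p _; rewrite phi_0; lra.
    + intros; lia.
    + intros x y _; exists (0, 0); split; [simpl; auto|].
      apply path_nodal.
      replace (0, 0) with (x + - x, y + - y) by (f_equal; ring).
      apply path_segment; intros; rewrite phi_0; lra.
Qed.

Lemma cas_1_sin t : cas 1 t = sqrt 2 * sin (2 * PI * (t + 1/8)).
Proof.
  unfold cas; rewrite Rmult_1_l.
  replace (2 * PI * (t + 1/8)) with (2 * PI * t + PI / 4) by field.
  rewrite sin_plus, cos_PI4, sin_PI4; field.
  apply Rgt_not_eq, sqrt_lt_R0; lra.
Qed.

Lemma cas_1_pos t : - (1/8) < t < 3/8 -> 0 < cas 1 t.
Proof.
  intros Ht; rewrite cas_1_sin; pose proof PI_RGT_0.
  apply Rmult_lt_0_compat; [apply sqrt_lt_R0; lra|apply sin_gt_0; nra].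
Qed.

Lemma cas_1_neg t : 3/8 < t < 7/8 -> cas 1 t < 0.
Proof.
  intros Ht; rewrite cas_1_sin; pose proof PI_RGT_0.
  assert (0 < sqrt 2) by (apply sqrt_lt_R0; lra).
  assert (sin (2 * PI * (t + 1/8)) < 0) by (apply sin_lt_0; nra).
  nra.
Qed.

Lemma cas_1_zero t : t = - (1/8) \/ t = 3/8 -> cas 1 t = 0.
Proof.
  intros Ht; rewrite cas_1_sin; destruct Ht as [-> | ->].
  - replace (2 * PI * (- (1/8) + 1/8)) with 0 by field; rewrite sin_0; ring.
  - replace (2 * PI * (3/8 + 1/8)) with PI by field; rewrite sin_PI; ring.
Qed.

Lemma phi_1_0 x y : phi 1 0 x y = cas 1 x.
Proof.
  unfold phi; replace (cas 0 y) with 1; [ring|].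
  unfold cas; rewrite !Rmult_0_l, Rmult_0_r, cos_0, sin_0; ring.
Qed.

Lemma courant_sharp_1 : courant_sharp (4 * PI^2).
Proof.
  exists (phi 1 0), 2%nat.
  assert (Hu : is_eigenfunction (4 * PI^2) (phi 1 0)).
  { replace (4 * PI^2) with (4 * PI^2 * IZR (1 * 1 + 0 * 0)) by (simpl; ring).
    apply phi_eigenfunction. }
  assert (Hper : periodic (phi 1 0)) by apply Hu.
  split; [exact Hu|split; [exact nu_1|]].
  assert (Hpq : ~ nodal_rel (phi 1 0) (1/8, 0) (5/8, 0)).
  { intros H; apply nodal_rel_path in H as [m [n [g1 [g2 [G1 [_ [G3 [_ [G5 [_ G7]]]]]]]]]].
    simpl in G3, G5.
    (* The function depends on [x] alone and has opposite signs at [1/8] and at every integer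
       translate of [5/8], so a joining path crosses a zero. *)
    pose (h := fun t => cas 1 (g1 t)).
    assert (Hh : continuity h) by (apply (continuity_comp g1 (cas 1)); auto using continuity_cas).
    assert (Hm : cas 1 (5/8 + IZR m) = cas 1 (5/8)).
    { exact (periodic_shift (fun x _ => cas 1 x) (fun x y => conj (cas_periodic 1 x) eq_refl)
        (5/8) 0 m 0%Z). }
    destruct (IVT_gen h 0 1 0 Hh) as [t [_ Ht]].
    - unfold h; rewrite G3, G5, Hm.
      pose proof (cas_1_pos (1/8) ltac:(lra)); pose proof (cas_1_neg (5/8) ltac:(lra)).
      unfold Rmin, Rmax; repeat destruct Rle_dec; lra.
    - apply (G7 t); rewrite phi_1_0; exact Ht. }
  exists [(1/8, 0); (5/8, 0)]; split; [auto|split; [|split]].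
  - intros p [<-|[<-|[]]]; simpl; rewrite phi_1_0.
    + apply Rgt_not_eq, cas_1_pos; lra.
    + apply Rlt_not_eq, cas_1_neg; lra.
  - intros [|[|i]] [|[|j]] Hi Hj Hij; try lia; simpl; auto.
    intros H; apply Hpq, nodal_rel_sym; auto.
  - intros x y Hxy.
    (* The period starts at the zero [- (1/8)], so that each sign of [cas 1] occupies one interval,
       with midpoints [1/8] and [5/8]. *)
    pose (k := (up (x + 1/8) - 1)%Z); pose (s := x + - IZR k).
    assert (Hs : - (1/8) <= s < 7/8).
    { destruct (archimed (x + 1/8)) as [A1 A2]; unfold s, k; rewrite minus_IZR; lra. }
    assert (Hshift : nodal_rel (phi 1 0) (x, y) (s, y)).
    { replace (s, y) with (shift (x, y) (- k) 0)
        by (unfold shift, s; simpl; rewrite opp_IZR; f_equal; ring).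
      apply nodal_rel_shift; auto. }
    assert (Hsxy : cas 1 s <> 0).
    { rewrite <- (phi_1_0 s y); unfold s; rewrite <- opp_IZR, <- (Rplus_0_r y).
      rewrite (periodic_shift _ Hper x y (- k) 0); auto. }
    assert (Hgo : forall c, (forall t, 0 <= t <= 1 -> cas 1 (s + t * (c - s)) <> 0) ->
      nodal_rel (phi 1 0) (x, y) (c, 0)).
    { intros c Hc; apply nodal_rel_trans with (1 := Hper) (2 := Hshift), path_nodal.
      replace (c, 0) with (s + (c - s), y + - y) by (f_equal; ring).
      apply path_segment; intros t Ht; rewrite phi_1_0; auto. }
    assert (Hs1 : s <> - (1/8)) by (intros E; apply Hsxy, cas_1_zero; auto).
    assert (Hs2 : s <> 3/8) by (intros E; apply Hsxy, cas_1_zero; auto).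
    destruct (Rlt_le_dec s (3/8)) as [Hlt|Hle].
    + exists (1/8, 0); split; [simpl; auto|].
      apply Hgo; intros t Ht; apply Rgt_not_eq, cas_1_pos; nra.
    + exists (5/8, 0); split; [simpl; auto|].
      apply Hgo; intros t Ht; apply Rlt_not_eq, cas_1_neg; nra.
Qed.

Theorem theorem1 (lam : R) (Hlam : is_eigenvalue lam) :
  (courant_sharp lam <-> exists k, (1 <= k <= 5)%nat /\ lambda_k k lam) /\
  (courant_sharp lam <-> lam = 0 \/ lam = 4 * PI ^ 2).
Proof.
  pose proof PI2_pos as HPI.
  destruct Hlam as [u Hu].
  destruct (eigenfunction_waves _ _ Hu) as [a [b [w [-> _]]]].
  set (N := (a * a + b * b)%Z).
  assert (HN : (N = 0 \/ N = 1 \/ 2 <= N)%Z) by (unfold N; nia).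
  destruct HN as [-> | [-> | HN]].
  - rewrite Rmult_0_r; pose proof courant_sharp_0 as H0.
    assert (exists k, (1 <= k <= 5)%nat /\ lambda_k k 0)
      by (exists 1%nat; split; [lia|apply nu_0]).
    tauto.
  - rewrite Rmult_1_r; pose proof courant_sharp_1 as H1.
    assert (exists k, (1 <= k <= 5)%nat /\ lambda_k k (4 * PI^2))
      by (exists 2%nat; split; [lia|apply nu_1]).
    tauto.
  - pose proof (not_courant_sharp N HN) as Hn.
    apply IZR_le in HN as HNr.
    split; (split; [contradiction|]).
    + intros [k [Hk1 Hk2]]; apply few_eigenvalues_below in Hk2; auto; lia.
    + intros [E|E]; nra.
Qed.
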